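(* Let $n\geq 1$. Let $v_1,\ldots,v_n$ be the standard basis of the natural $\mathbb C\mathfrak T_n$-module $\mathbb C^n$, let $w_i=v_i-v_n$ for $1\leq i\leq n-1$ and let $w_n=v_1+\cdots+v_n$. Let $V=\mathrm{Aug}(\mathbb C^n)$. Then, for $1\leq r\leq n$, the minimal projective resolution of the simple $\mathbb C\mathfrak T_n$-module $\Lambda^{r-1}(V)$ is \[0\longrightarrow P_{n-r}\xrightarrow{d_{n-r}}\cdots\xrightarrow{d_1}P_0\xrightarrow{d_0}\Lambda^{r-1}(V)\longrightarrow 0\] where $P_q=\Lambda^{q+r}(\mathbb C^n)$ for $0\le q\le n-r$ and, for $1\leq i_1<\cdots<i_{q+r}\leq n$, \[d_q(w_{i_1}\wedge\cdots\wedge w_{i_{q+r}})=\begin{cases}w_{i_1}\wedge\cdots\wedge w_{i_{q+r-1}}, & \text{if } i_{q+r}=n,\\ 0, & \text{else.}\end{cases}\] Therefore, the projective dimension of $\Lambda^{r-1}(V)$ is $n-r$ for $1\leq r\leq n$. In particular, the projective dimension of the trivial $\mathbb C\mathfrak T_n$-module is $n-1$.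
   Context: $\mathfrak T_n$ is the monoid of all self-maps of $[n]=\{1,\ldots,n\}$ under composition. All modules are left modules. The natural $\mathbb C\mathfrak T_n$-module is $\mathbb C^n$ with $f v_i=v_{f(i)}$ for $f\in\mathfrak T_n$; its augmentation submodule is $\mathrm{Aug}(\mathbb C^n)=\{(x_1,\ldots,x_n)\in\mathbb C^n\mid x_1+\cdots+x_n=0\}$. Exterior powers are taken over $\mathbb C$, with $f\in \mathfrak T_n$ acting by $f(u_1\wedge\cdots\wedge u_k)=fu_1\wedge\cdots\wedge fu_k$ (and trivially on $\Lambda^0=\mathbb C$). The trivial module is $\mathbb C$ with every $f\in\mathfrak T_n$ acting as the identity. A projective resolution $P_\bullet\to M$ with boundary maps $d_q$ is minimal if each $d_q\colon P_q\to d_q(P_q)$ is a projective cover. *)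

(* Defs.v *)
From HB Require Import structures.
From mathcomp Require Import all_boot all_order all_algebra all_fingroup.
From mathcomp Require Import boolp classical_sets reals complex.

Set Implicit Arguments.
Unset Strict Implicit.
Unset Printing Implicit Defensive.

Import GRing.Theory.
Local Open Scope ring_scope.
Local Open Scope classical_set_scope.

Section Homological.
Variable A : nzRingType.

Definition submodule (M : lmodType A) (K : set M) : Prop :=
  K 0 /\ forall (a : A) (x y : M), K x -> K y -> K (a *: x + y).

Definition simple_module (M : lmodType A) : Prop :=
  (exists x : M, x <> 0) /\
  forall K : set M, submodule K -> K = [set 0] \/ K = setT.

Definition kernel (M N : lmodType A) (f : {linear M -> N}) : set M :=
  [set x | f x = 0].

Definition projective_module (P : lmodType A) : Prop :=
  forall (M N : lmodType A) (g : {linear M -> N}) (f : {linear P -> N}),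
    (forall y : N, exists x : M, g x = y) ->
    exists h : {linear P -> M}, forall x : P, g (h x) = f x.

Definition superfluous (M : lmodType A) (K : set M) : Prop :=
  forall X : set M, submodule X ->
    (forall x : M, exists y z : M, [/\ X y, K z & x = y + z]) -> X = setT.

(* [f], corestricted to the submodule [I] of [N], is a projective cover of [I] *)
Definition projective_cover (P N : lmodType A) (f : {linear P -> N})
    (I : set N) : Prop :=
  [/\ projective_module P, range f = I & superfluous (kernel f)].

(* [eps] is the augmentation d_0 : P_0 -> M and [d q] is d_{q+1} *)
Definition projective_resolution (M : lmodType A) (P : nat -> lmodType A)
    (eps : {linear P 0 -> M}) (d : forall q : nat, {linear P q.+1 -> P q})
    : Prop :=
  [/\ forall q : nat, projective_module (P q),
      range eps = setT,
      range (d 0) = kernel eps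
    & forall q : nat, range (d q.+1) = kernel (d q)].

Definition minimal_projective_resolution (M : lmodType A)
    (P : nat -> lmodType A) (eps : {linear P 0 -> M})
    (d : forall q : nat, {linear P q.+1 -> P q}) : Prop :=
  [/\ projective_resolution eps d,
      projective_cover eps (range eps)
    & forall q : nat, projective_cover (d q) (range (d q))].

Definition vanishes_above (P : nat -> lmodType A) (l : nat) : Prop :=
  forall q : nat, (l < q)%N -> forall x : P q, x = 0.

Definition has_resolution_of_length (M : lmodType A) (l : nat) : Prop :=
  exists (P : nat -> lmodType A) (eps : {linear P 0 -> M})
    (d : forall q : nat, {linear P q.+1 -> P q}),
    projective_resolution eps d /\ vanishes_above P l.

Definition projective_dimension_is (M : lmodType A) (l : nat) : Prop :=
  has_resolution_of_length M l /\
  forall l' : nat, has_resolution_of_length M l' -> (l <= l')%N.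

End Homological.

Definition transf (n : nat) := {ffun 'I_n -> 'I_n}.
HB.instance Definition _ n := Finite.on (transf n).

Section TransfMonoid.
Variable n : nat.
Definition transf_mul (f g : transf n) : transf n := [ffun i => f (g i)].
Definition transf_one : transf n := [ffun i => i].

Lemma transf_mulA : associative transf_mul.
Proof. by move=> f g h; apply/ffunP=> i; rewrite !ffunE. Qed.
Lemma transf_mul1 : left_id transf_one transf_mul.
Proof. by move=> f; apply/ffunP=> i; rewrite !ffunE. Qed.
Lemma transf_mulr1 : right_id transf_one transf_mul.
Proof. by move=> f; apply/ffunP=> i; rewrite !ffunE. Qed.

HB.instance Definition _ :=
  isMonoid.Build (transf n) transf_mulA transf_mul1 transf_mulr1.
End TransfMonoid.

Lemma transfM n (f g : transf n) i : (f * g)%g i = f (g i).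
Proof. by rewrite ffunE. Qed.
Lemma transf1 n i : (1%g : transf n) i = i.
Proof. by rewrite ffunE. Qed.

(* The monoid algebra of the full transformation monoid, as coefficient
   functions with the convolution product. *)
Definition transf_alg (F : fieldType) (n : nat) := {ffun transf n -> F}.

Section TransfAlg.
Variables (F : fieldType) (n : nat).
Local Notation T := (transf n).
Local Notation A := (transf_alg F n).

HB.instance Definition _ := GRing.Zmodule.on A.

Definition talg_of (f : T) : A := [ffun h => (h == f)%:R].
Definition talg_mul (a b : A) : A :=
  [ffun h => \sum_(p : T * T | (p.1 * p.2)%g == h) a p.1 * b p.2].

Lemma talg_mul_sum (V : zmodType) (G : F -> T -> V) (a b : A) :
    (forall h x y, G (x + y) h = G x h + G y h) ->
  \sum_h G (talg_mul a b h) h = \sum_f \sum_g G (a f * b g) (f * g)%g.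
Proof.
move=> GD; have G0 h : G 0 h = 0.
  by apply: (addrI (G 0 h)); rewrite -GD !addr0.
rewrite pair_big /= (partition_big (fun p : T * T => (p.1 * p.2)%g) predT) //=.
apply: eq_bigr => h _; rewrite ffunE.
rewrite (big_morph (fun x => G x h) (GD h) (G0 h)).
by apply: eq_bigr => p /eqP->.
Qed.

Lemma talg_mulE (a b : A) h :
  talg_mul a b h = \sum_f \sum_g a f * b g * (h == (f * g)%g)%:R.
Proof.
rewrite -(talg_mul_sum (G := fun x f => x * (h == f)%:R)); last first.
  by move=> *; rewrite mulrDl.
rewrite (bigD1 h) //= eqxx mulr1 big1 ?addr0 // => f /negPf.
by rewrite eq_sym => ->; rewrite mulr0.
Qed.

Lemma talg_mulA : associative talg_mul.
Proof.
move=> a b c; apply/ffunP=> h; rewrite !talg_mulE.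
transitivity (\sum_f \sum_g \sum_k
    a f * b g * c k * (h == (f * g * k)%g)%:R).
  apply: eq_bigr => f _.
  rewrite (talg_mul_sum (G := fun x g => a f * x * (h == (f * g)%g)%:R)).
    apply: eq_bigr => g _; apply: eq_bigr => k _.
    by rewrite mulrA; congr (_ * (_ == _)%:R); apply: mulgA.
  by move=> *; rewrite mulrDr mulrDl.
rewrite (talg_mul_sum (G := fun x f => \sum_k x * c k * (h == (f * k)%g)%:R)) //.
by move=> k x y; rewrite -big_split; apply: eq_bigr => *; rewrite !mulrDl.
Qed.

Lemma talg_mul1 : left_id (talg_of 1%g) talg_mul.
Proof.
move=> a; apply/ffunP=> h; rewrite talg_mulE (bigD1 (1%g : T)) //=.
rewrite [X in _ + X]big1 ?addr0 => [|f /negPf f1]; last first.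
  by rewrite big1 // => g _; rewrite ffunE f1 !mul0r.
rewrite (bigD1 h) //= mul1g eqxx ffunE eqxx !mul1r mulr1 big1 ?addr0 //.
by move=> g /negPf; rewrite mul1g eq_sym => ->; rewrite mulr0.
Qed.

Lemma talg_mulr1 : right_id (talg_of 1%g) talg_mul.
Proof.
move=> a; apply/ffunP=> h; rewrite talg_mulE exchange_big (bigD1 (1%g : T)) //=.
rewrite [X in _ + X]big1 ?addr0 => [|f /negPf f1]; last first.
  by rewrite big1 // => g _; rewrite [talg_of _ _]ffunE f1 mulr0 mul0r.
rewrite (bigD1 h) //= mulg1 eqxx [talg_of _ _]ffunE eqxx !mulr1 big1 ?addr0 //.
by move=> g /negPf; rewrite mulg1 eq_sym => ->; rewrite mulr0.
Qed.

Lemma talg_mulDl : left_distributive talg_mul +%R.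
Proof.
move=> a b c; apply/ffunP=> h; rewrite !ffunE -big_split.
by apply: eq_bigr => p _; rewrite ffunE mulrDl.
Qed.

Lemma talg_mulDr : right_distributive talg_mul +%R.
Proof.
move=> a b c; apply/ffunP=> h; rewrite !ffunE -big_split.
by apply: eq_bigr => p _; rewrite ffunE mulrDr.
Qed.

Lemma talg_1neq0 : talg_of 1%g != 0.
Proof.
by apply/eqP=> /ffunP/(_ 1%g); rewrite !ffunE eqxx => /eqP; rewrite oner_eq0.
Qed.

HB.instance Definition _ := GRing.Zmodule_isNzRing.Build A
  talg_mulA talg_mul1 talg_mulr1 talg_mulDl talg_mulDr talg_1neq0.
End TransfAlg.

(* Finite dimensional linear representations of the full transformation monoid,
   and the modules over its monoid algebra that they define. *)
Record trep (F : fieldType) (n : nat) := TRep {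
  trep_space :> vectType F;
  trep_act : transf n -> {linear trep_space -> trep_space};
  trep_act1 : forall x : trep_space, trep_act 1%g x = x;
  trep_actM : forall (f g : transf n) (x : trep_space),
    trep_act (f * g)%g x = trep_act f (trep_act g x)
}.

Definition tmod (F : fieldType) (n : nat) (V : trep F n) : Type := V.

Section TMod.
Variables (F : fieldType) (n : nat) (V : trep F n).
Local Notation A := (transf_alg F n).

HB.instance Definition _ := GRing.Zmodule.on (tmod V).

Definition tmod_scale (a : A) (x : tmod V) : tmod V :=
  \sum_(f : transf n) a f *: trep_act V f x.

Lemma tmod_scaleA a b x : tmod_scale a (tmod_scale b x) = tmod_scale (a * b) x.
Proof.
rewrite /tmod_scale (talg_mul_sum (G := fun c f => c *: trep_act V f x)).
  apply: eq_bigr => f _; rewrite linear_sum scaler_sumr.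
  by apply: eq_bigr => g _; rewrite linearZ /= scalerA trep_actM.
by move=> *; rewrite scalerDl.
Qed.

Lemma tmod_of (f : transf n) x : tmod_scale (talg_of F f) x = trep_act V f x.
Proof.
rewrite /tmod_scale (bigD1 f) //= ffunE eqxx scale1r big1 ?addr0 //.
by move=> g /negPf gf; rewrite ffunE gf scale0r.
Qed.

Lemma tmod_scale1 : left_id 1 tmod_scale.
Proof. by move=> x; rewrite tmod_of trep_act1. Qed.

Lemma tmod_scaleDr : right_distributive tmod_scale +%R.
Proof.
move=> a x y; rewrite /tmod_scale -big_split.
by apply: eq_bigr => f _; rewrite linearD scalerDr.
Qed.

Lemma tmod_scaleDl x : {morph tmod_scale^~ x : a b / a + b}.
Proof.
move=> a b; rewrite /tmod_scale -big_split.
by apply: eq_bigr => f _; rewrite ffunE scalerDl.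
Qed.

HB.instance Definition _ := GRing.Zmodule_isLmodule.Build A (tmod V)
  tmod_scaleA tmod_scale1 tmod_scaleDr tmod_scaleDl.

Lemma tmod_ofE (f : transf n) (x : tmod V) : talg_of F f *: x = trep_act V f x.
Proof. exact: tmod_of. Qed.
End TMod.

Section ExteriorPower.
Variable F : fieldType.

Definition increasing k m (g : {ffun 'I_k -> 'I_m}) : bool :=
  [forall i : 'I_k, forall j : 'I_k, (i < j)%N ==> (g i < g j)%N].
Definition incseq k m := {g : {ffun 'I_k -> 'I_m} | increasing g}.
HB.instance Definition _ k m := Finite.on (incseq k m).

Definition ffupd (k : nat) (V : Type) (u : {ffun 'I_k -> V}) (i : 'I_k) (x : V)
  : {ffun 'I_k -> V} := [ffun j => if j == i then x else u j].

Definition multilinear k (V W : lmodType F) (phi : {ffun 'I_k -> V} -> W) :=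
  forall (u : {ffun 'I_k -> V}) (i : 'I_k) (a : F) (x y : V),
    phi (ffupd u i (a *: x + y)) = a *: phi (ffupd u i x) + phi (ffupd u i y).

Definition alternating k (V W : lmodType F) (phi : {ffun 'I_k -> V} -> W) :=
  forall (u : {ffun 'I_k -> V}) (i j : 'I_k), i != j -> u i = u j -> phi u = 0.

(* The k-th exterior power of V in coordinates: (b_j) being the basis
   [vbasis {:V}] of V, the space with basis b_{i_1} /\ ... /\ b_{i_k} for
   i_1 < ... < i_k; the coordinates of u_1 /\ ... /\ u_k are the k x k minors of
   the matrix of coordinates of the u_i. By [wedge_universal] below, this has
   the universal property of the exterior power, whatever the basis. *)
Definition extpow (k : nat) (V : vectType F) : Type :=
  {ffun incseq k (\dim {:V}) -> F^o}.
HB.instance Definition _ k V := Vector.on (extpow k V).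

Definition wedge k (V : vectType F) (u : {ffun 'I_k -> V}) : extpow k V :=
  [ffun g : incseq k (\dim {:V}) =>
     \det (\matrix_(i, j) coord (vbasis {:V}) (val g j) (u i))].

Section Universal.
Variable k : nat.

Lemma ffupd_id (V : Type) (u : {ffun 'I_k -> V}) i : ffupd u i (u i) = u.
Proof. by apply/ffunP=> j; rewrite ffunE; case: eqP => [->|]. Qed.

Lemma ffupdC (V : Type) (u : {ffun 'I_k -> V}) i j x y : i != j ->
  ffupd (ffupd u i x) j y = ffupd (ffupd u j y) i x.
Proof.
move=> ij; apply/ffunP=> l; rewrite !ffunE.
by case: (eqVneq l i) => [->|//]; rewrite (negPf ij).
Qed.

Section AltMult.
Variables (V : vectType F) (W : lmodType F) (phi : {ffun 'I_k -> V} -> W).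
Hypotheses (phiM : multilinear phi) (phiA : alternating phi).
Local Notation m := (\dim {:V}).
Local Notation b := (fun i : 'I_m => (vbasis {:V})`_i).

Lemma multilinear0 u i : phi (ffupd u i 0) = 0.
Proof.
have := phiM u i 1 0 0; rewrite !scale1r add0r => /(congr1 (fun x => x - phi (ffupd u i 0))).
by rewrite addrK subrr => <-.
Qed.

Lemma multilinearD u i x y :
  phi (ffupd u i (x + y)) = phi (ffupd u i x) + phi (ffupd u i y).
Proof. by have := phiM u i 1 x y; rewrite !scale1r. Qed.

Lemma alternating_tperm (u : {ffun 'I_k -> V}) (i j : 'I_k) : i != j ->
  phi [ffun l => u (tperm i j l)] = - phi u.
Proof.
move=> ij; pose U x y := ffupd (ffupd u i x) j y.
have Ud x : phi (U x x) = 0.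
  apply: (phiA ij); rewrite /U !ffunE !eqxx.
  by case: eqP => // e; rewrite e eqxx in ij.
have Uu : U (u i) (u j) = u by rewrite /U !ffupd_id.
have Ut : U (u j) (u i) = [ffun l => u (tperm i j l)].
  apply/ffunP=> l; rewrite !ffunE.
  case: (tpermP i j l) => [->|->|/eqP/negPf -> /eqP/negPf ->] //.
    by rewrite eqxx (negPf ij).
  by rewrite eqxx.
have Dl x y z : phi (U (x + y) z) = phi (U x z) + phi (U y z).
  by rewrite /U !(ffupdC _ _ _ ij) multilinearD.
have := Ud (u i + u j).
rewrite Dl /U !multilinearD -!/(U _ _) !Ud addr0 add0r Uu Ut => /eqP.
by rewrite addrC addr_eq0 => /eqP.
Qed.

Lemma alternating_perm (u : {ffun 'I_k -> V}) (s : 'S_k) :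
  phi u = 0 -> phi [ffun l => u (s l)] = 0.
Proof.
have [ts -> _] := prod_tpermP s; elim: ts u => [|t ts IH] u u0.
  rewrite big_nil -u0; congr phi; apply/ffunP=> l.
  by rewrite ffunE perm1.
rewrite big_cons.
have -> : [ffun l => u ((tperm t.1 t.2 * \prod_(t0 <- ts) tperm t0.1 t0.2)%g l)]
   = [ffun l => [ffun l' => u ((\prod_(t0 <- ts) tperm t0.1 t0.2)%g l')]
        (tperm t.1 t.2 l)].
  by apply/ffunP=> l; rewrite !ffunE permM.
case: (eqVneq t.1 t.2) => [->|t12]; last by rewrite alternating_tperm // IH ?oppr0.
rewrite tperm1 -[RHS](IH u u0); congr phi.
by apply/ffunP=> l; rewrite !ffunE perm1.
Qed.

Lemma altmult_eq0 :
  (forall g : incseq k m, phi [ffun i => b (val g i)] = 0) ->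
  forall u, phi u = 0.
Proof.
move=> phi0.
have {phi0} phi0 (f : {ffun 'I_k -> 'I_m}) : phi [ffun i => b (f i)] = 0.
  case: (boolP (injectiveb f)) => [/injectiveP f_inj|/injectivePn]; last first.
    by case=> i [j ij fij]; apply: (phiA ij); rewrite !ffunE fij.
  pose t : k.-tuple nat := [tuple (f i : nat) | i < k].
  have : perm_eq (sort leq t) t by rewrite perm_sort.
  have szt : size (sort leq t) == k by rewrite size_sort size_tuple.
  case/(@tuple_permP _ _ (Tuple szt) t) => s es.
  have ut : uniq t.
    rewrite map_inj_uniq ?enum_uniq // => i j /val_inj.
    exact: f_inj.
  have st : sorted ltn (sort leq t).
    by rewrite ltn_sorted_uniq_leq sort_uniq ut sort_sorted //; apply: leq_total.
  pose g : {ffun 'I_k -> 'I_m} := [ffun i => f (s i)].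
  have ginc : increasing g.
    apply/forallP=> i; apply/forallP=> j; apply/implyP=> ij.
    have nthE (l : 'I_k) : nth 0%N (sort leq t) l = g l.
      have -> : sort leq t = [tuple tnth t (s i0)  | i0 < k] by exact: es.
      by rewrite -tnth_nth !tnth_mktuple ffunE.
    rewrite -!nthE; apply: (sorted_ltn_nth ltn_trans) => //.
    - by rewrite inE (eqP szt).
    - by rewrite inE (eqP szt).
  have /(alternating_perm (s^-1)%g) := phi0 (exist _ g ginc).
  move=> <-; congr phi; apply/ffunP=> i.
  by rewrite !ffunE /= permKV.
suff main (p : nat) (u : {ffun 'I_k -> V}) :
    (forall i : 'I_k, (p <= i)%N -> exists j, u i = b j) -> phi u = 0.
  by move=> u; apply: (main k) => i; rewrite leqNgt ltn_ord.
elim: p u => [|p IH] u up.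
  have [f fP] := fin_all_exists (fun i => up i isT).
  rewrite -(phi0 (finfun f)); congr phi; apply/ffunP=> i.
  by rewrite !ffunE fP.
case: (ltnP p k) => [pk|kp]; last first.
  by apply: IH => i pi; move: (ltn_ord i); rewrite ltnNge (leq_trans kp).
pose i0 := Ordinal pk.
rewrite -(ffupd_id u i0) [u i0](coord_vbasis (memvf _)).
elim/big_rec: _ => [|j x _ IHx]; first exact: multilinear0.
rewrite phiM IHx addr0 IH ?scaler0 // => i pi; rewrite ffunE.
case: eqP => [_|ne]; first by exists j.
apply: up; rewrite ltn_neqAle pi andbT; apply/eqP=> e; apply: ne.
exact: val_inj.
Qed.
End AltMult.

Variable V : vectType F.
Local Notation m := (\dim {:V}).
Local Notation b := (fun i : 'I_m => (vbasis {:V})`_i).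

Lemma wedge_multilinear : multilinear (@wedge k V).
Proof.
move=> u i a x y; apply/ffunP=> g; rewrite !ffunE /GRing.scale /=.
rewrite -[X in _ = _ + X]mul1r.
apply: (determinant_multilinear (i0 := i)).
- apply/rowP=> j; rewrite !mxE !ffunE eqxx linearP /=.
  by rewrite mul1r.
- by apply/matrixP=> l j; rewrite !mxE !ffunE eq_sym (negPf (neq_lift _ _)).
- by apply/matrixP=> l j; rewrite !mxE !ffunE eq_sym (negPf (neq_lift _ _)).
Qed.

Lemma wedge_alternating : alternating (@wedge k V).
Proof.
move=> u i j ij uij; apply/ffunP=> g; rewrite !ffunE.
by apply: (determinant_alternate ij) => l; rewrite !mxE uij.
Qed.

Lemma increasing_eq (g h : incseq k m) :
  (forall i, exists j, val g i = val h j) -> g = h.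
Proof.
move=> gh; pose s (f : incseq k m) := [seq val f i | i <- enum 'I_k].
have ss f : sorted (relpre val ltn) (s f).
  rewrite /s sorted_map; have := iota_ltn_sorted 0 k.
  rewrite -val_enum_ord sorted_map; apply: sub_sorted => i j /= ij.
  by case: f => f /= /forallP/(_ i)/forallP/(_ j)/implyP; apply.
have tr : transitive (relpre (val : 'I_m -> nat) ltn).
  by move=> ? ? ?; apply: ltn_trans.
have ir : irreflexive (relpre (val : 'I_m -> nat) ltn).
  by move=> ?; apply: ltnn.
have us f : uniq (s f) := sorted_uniq tr ir (ss f).
have sub : {subset s g <= s h}.
  move=> _ /mapP[i _ ->]; have [j ->] := gh i.
  by apply: map_f; rewrite mem_enum.
have [] := uniq_min_size (us g) sub; first by rewrite !size_map.
move=> _ /(irr_sorted_eq tr ir (ss g) (ss h)) e.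
apply/val_inj/ffunP=> i.
have := congr1 (fun t => nth (val g i) t i) e.
have ik : (i < size (enum 'I_k))%N by rewrite size_enum_ord.
have ei : nth i (enum 'I_k) i = i by apply: val_inj; rewrite /= nth_enum_ord.
have E f : nth (val g i) (s f) i = val f i.
  by rewrite (nth_map i) //; congr (val f _); exact: ei.
by rewrite !E.
Qed.

Lemma incseq_inj (g : incseq k m) : injective (val g).
Proof.
case: g => g /= /forallP gP i j gij; apply/val_inj/eqP; rewrite eqn_leq
  [(i <= j)%N]leqNgt [(j <= i)%N]leqNgt.
have gl (l l' : 'I_k) : (l < l')%N -> (g l < g l')%N.
  by move: (gP l) => /forallP/(_ l')/implyP.
by apply/andP; split; apply/negP=> /gl; rewrite gij ltnn.
Qed.

Lemma wedge_basis (g h : incseq k m) :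
  wedge [ffun i => b (val g i)] h = (g == h)%:R.
Proof.
rewrite ffunE; have bf := basis_free (vbasisP {:V}).
under eq_mx do rewrite ffunE coord_free //.
case: eqP => [{g}->|gh].
  rewrite -[RHS](det1 _ k); congr (\det _); apply/matrixP=> i j.
  by rewrite !mxE -(inj_eq (@incseq_inj h)) eq_sym.
have [i gi] : exists i, forall j, val g i <> val h j.
  apply: contrapT => /forallNP H; apply: gh; apply: increasing_eq => i.
  by apply: contrapT => /forallNP; apply: H.
rewrite (expand_det_row _ i) big1 // => j _; rewrite mxE.
by case: eqP => [/gi//|]; rewrite mul0r.
Qed.

Lemma extpow_sum (x : extpow k V) :
  x = \sum_g x g *: wedge [ffun i => b (val g i)].
Proof.
apply/ffunP=> h; rewrite sum_ffunE (bigD1 h) //= big1 => [|g /negPf gh].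
  by rewrite ffunE wedge_basis eqxx addr0 /GRing.scale /= mulr1.
by rewrite ffunE wedge_basis gh scaler0.
Qed.

Definition extpow_lift (W : lmodType F) (phi : {ffun 'I_k -> V} -> W)
    (x : extpow k V) : W :=
  \sum_g x g *: phi [ffun i => b (val g i)].

Lemma extpow_lift_linear (W : lmodType F) (phi : {ffun 'I_k -> V} -> W) : linear (@extpow_lift W phi).
Proof.
move=> a x y; rewrite scaler_sumr -big_split; apply: eq_bigr => g _.
by rewrite !ffunE scalerDl -scalerA.
Qed.

HB.instance Definition _ (W : lmodType F) (phi : {ffun 'I_k -> V} -> W) :=
  GRing.isLinear.Build F (extpow k V) W *:%R (@extpow_lift W phi)
  (@extpow_lift_linear W phi).

Lemma extpow_lift_wedge (W : lmodType F) (phi : {ffun 'I_k -> V} -> W) u :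
  multilinear phi -> alternating phi -> extpow_lift phi (wedge u) = phi u.
Proof.
move=> phiM phiA; apply/eqP; rewrite -subr_eq0; apply/eqP.
pose psi (v : {ffun 'I_k -> V}) := extpow_lift phi (wedge v) - phi v.
apply: (@altmult_eq0 V W psi).
- move=> v i a x y; rewrite /psi wedge_multilinear phiM linearP /=.
  by rewrite scalerBr opprD addrACA.
- move=> v i j ij vij; rewrite /psi (wedge_alternating ij vij) (phiA v i j) //.
  by rewrite linear0 subr0.
- move=> g; rewrite /psi /extpow_lift (bigD1 g) //= big1 => [|h /negPf hg].
    by rewrite wedge_basis eqxx scale1r addr0 subrr.
  by rewrite wedge_basis eq_sym hg scale0r.
Qed.

Lemma extpow_linear_eq (W : lmodType F) (f g : {linear extpow k V -> W}) :
  (forall u, f (wedge u) = g (wedge u)) -> f =1 g.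
Proof.
move=> fg x; rewrite (extpow_sum x) !linear_sum; apply: eq_bigr => h _.
by rewrite !linearZ /= fg.
Qed.

Theorem wedge_universal (W : lmodType F) (phi : {ffun 'I_k -> V} -> W) :
  multilinear phi -> alternating phi ->
  exists2 h : {linear extpow k V -> W},
    forall u, h (wedge u) = phi u
  & forall h' : {linear extpow k V -> W},
      (forall u, h' (wedge u) = phi u) -> h' =1 h.
Proof.
move=> phiM phiA; exists (extpow_lift phi) => [u|h' h'P].
  exact: extpow_lift_wedge.
by apply: extpow_linear_eq => u; rewrite h'P [RHS]extpow_lift_wedge.
Qed.
End Universal.

(* the linear map u_1 /\ ... /\ u_k |-> f u_1 /\ ... /\ f u_k, see
   [extpow_map_wedge] *)
Definition extpow_map k (V W : vectType F) (f : {linear V -> W})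
    : {linear extpow k V -> extpow k W} :=
  extpow_lift (fun u : {ffun 'I_k -> V} => wedge [ffun i => f (u i)]).

Lemma extpow_map_wedge k (V W : vectType F) (f : {linear V -> W})
    (u : {ffun 'I_k -> V}) :
  extpow_map k f (wedge u) = wedge [ffun i => f (u i)].
Proof.
apply: extpow_lift_wedge => {u} [u i a x y|u i j ij uij]; last first.
  by apply: (wedge_alternating ij); rewrite !ffunE uij.
have fu z : [ffun j => f (ffupd u i z j)] = ffupd [ffun j => f (u j)] i (f z).
  by apply/ffunP=> j; rewrite !ffunE; case: ifP.
by rewrite !fu linearP wedge_multilinear.
Qed.
End ExteriorPower.

Section ExteriorRep.
Variables (F : fieldType) (n k : nat) (V : trep F n).

Definition extrep_act (f : transf n) := extpow_map k (trep_act V f).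

Lemma extrep_act1 x : extrep_act 1%g x = x.
Proof.
apply: (@extpow_linear_eq _ _ _ _ (extrep_act 1%g) idfun) => u.
rewrite [LHS]extpow_map_wedge; congr wedge; apply/ffunP=> i.
by rewrite ffunE trep_act1.
Qed.

Lemma extrep_actM f g x :
  extrep_act (f * g)%g x = extrep_act f (extrep_act g x).
Proof.
apply: (@extpow_linear_eq _ _ _ _ (extrep_act (f * g)%g)
  (extrep_act f \o extrep_act g)) => u.
rewrite /= [LHS]extpow_map_wedge !extpow_map_wedge; congr wedge.
by apply/ffunP=> i; rewrite !ffunE trep_actM.
Qed.

Definition extrep : trep F n := TRep extrep_act1 extrep_actM.

Lemma extrep_wedge (f : transf n) (u : {ffun 'I_k -> V}) :
  trep_act extrep f (wedge u) = wedge [ffun i => trep_act V f (u i)].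
Proof. exact: extpow_map_wedge. Qed.
End ExteriorRep.

Section StandardReps.
Variables (F : fieldType) (n : nat).

Definition nat_act (f : transf n) (x : 'rV[F]_n) : 'rV[F]_n :=
  \sum_(i < n) x 0 i *: delta_mx 0 (f i).

Lemma nat_act_linear f : linear (nat_act f).
Proof.
move=> a x y; rewrite scaler_sumr -big_split; apply: eq_bigr => i _.
by rewrite !mxE scalerDl scalerA.
Qed.

HB.instance Definition _ f := GRing.isLinear.Build F 'rV[F]_n 'rV[F]_n *:%R
  (nat_act f) (nat_act_linear f).

Lemma nat_act_delta f i : nat_act f (delta_mx 0 i) = delta_mx 0 (f i).
Proof.
rewrite /nat_act (bigD1 i) //= big1 => [|j /negPf ji].
  by rewrite mxE !eqxx scale1r addr0.
by rewrite mxE ji andbF scale0r.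
Qed.

Lemma nat_act1 x : nat_act 1%g x = x.
Proof.
rewrite [RHS]row_sum_delta; apply: eq_bigr => i _.
by rewrite transf1.
Qed.

Lemma nat_actM f g x : nat_act (f * g)%g x = nat_act f (nat_act g x).
Proof.
rewrite [nat_act g x]/nat_act linear_sum; apply: eq_bigr => i _.
by rewrite linearZ /= nat_act_delta transfM.
Qed.

Definition natrep : trep F n := TRep (trep_act := nat_act) nat_act1 nat_actM.

Definition coord_sum (x : 'rV[F]_n) : F^o := \sum_(i < n) x 0 i.

Lemma coord_sum_linear : linear coord_sum.
Proof.
move=> a x y; rewrite scaler_sumr -big_split; apply: eq_bigr => i _.
by rewrite !mxE.
Qed.

HB.instance Definition _ := GRing.isLinear.Build F 'rV[F]_n F^o *:%R
  coord_sum coord_sum_linear.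

Definition augsp : {vspace 'rV[F]_n} := lker (linfun coord_sum).

Lemma mem_augsp x : (x \in augsp) = (\sum_(i < n) x 0 i == 0).
Proof. by rewrite memv_ker lfunE. Qed.

Lemma nat_act_aug f x : x \in augsp -> nat_act f x \in augsp.
Proof.
rewrite !memv_ker !lfunE /= => /eqP x0; apply/eqP.
rewrite /nat_act linear_sum -[RHS]x0; apply: eq_bigr => i _.
rewrite linearZ /= /coord_sum (bigD1 (f i)) //= big1 => [|j /negPf jf].
  by rewrite mxE !eqxx addr0 [LHS]mulr1.
by rewrite mxE jf andbF.
Qed.

Definition aug_act (f : transf n) (x : subvs_of augsp) : subvs_of augsp :=
  Subvs (nat_act_aug f (subvsP x)).

Lemma aug_act_linear f : linear (aug_act f).
Proof. by move=> a x y; apply: val_inj; rewrite /= linearP. Qed.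

HB.instance Definition _ f := GRing.isLinear.Build F (subvs_of augsp)
  (subvs_of augsp) *:%R (aug_act f) (aug_act_linear f).

Lemma aug_act1 x : aug_act 1%g x = x.
Proof. by apply: val_inj; rewrite /= nat_act1. Qed.

Lemma aug_actM f g x : aug_act (f * g)%g x = aug_act f (aug_act g x).
Proof. by apply: val_inj; rewrite /= nat_actM. Qed.

Definition augrep : trep F n := TRep (trep_act := aug_act) aug_act1 aug_actM.

Definition trivrep : trep F n :=
  @TRep F n F^o (fun _ => idfun) (fun x => erefl x) (fun _ _ x => erefl x).

End StandardReps.

(* the last position 'n' of {1, ..., n}, i.e. n - 1 in 'I_n *)
Definition ord_last (n : nat) (hn : (0 < n)%N) : 'I_n :=
  Ordinal (etrans (congr1 (fun m => (m <= n)%N) (prednK hn)) (leqnn n)).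

Section Basis.
Variables (F : fieldType) (n : nat) (hn : (0 < n)%N).

Definition vvec (i : 'I_n) : 'rV[F]_n := delta_mx 0 i.

Definition wvec (i : 'I_n) : 'rV[F]_n :=
  if i == ord_last hn then \sum_(j < n) vvec j else vvec i - vvec (ord_last hn).

Lemma sub_vvec_aug i j : vvec i - vvec j \in augsp F n.
Proof.
rewrite mem_augsp; apply/eqP.
have s (l : 'I_n) : \sum_(l' < n) (l' == l)%:R = 1 :> F.
  by rewrite (bigD1 l) //= eqxx big1 ?addr0 // => l' /negPf ->.
by under eq_bigr do rewrite !mxE /=; rewrite big_split sumrN /= !s subrr.
Qed.

(* w_i = v_i - v_n as an element of Aug(C^n), meant for i < n *)
Definition waug (i : 'I_n) : subvs_of (augsp F n) :=
  Subvs (sub_vvec_aug i (ord_last hn)).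

End Basis.

(* i_1 < ... < i_{k-1}, from i_1 < ... < i_k *)
Definition init_seq k n (g : {ffun 'I_k -> 'I_n}) : {ffun 'I_k.-1 -> 'I_n} :=
  [ffun j => g (widen_ord (leq_pred k) j)].

(* Main.v *)
(* Over a field of characteristic 0, let t^ in T_n extend t : [k] -> [n], where
   1 <= k <= n. The map u_1 /\ ... /\ u_k |-> 1/k! sum_t det(u_i(t_j)) t^
   embeds the exterior power Lambda^k of the natural module into the regular
   module, with left inverse a |-> a (v_1 /\ ... /\ v_k); hence Lambda^k is
   projective and generated by v_1 /\ ... /\ v_k.
   The differentials are the contractions by the average of the coordinates, an
   invariant functional that is dual to w_n in the basis w_1, ..., w_n. Exterior
   multiplication by w_n is a contracting homotopy (not equivariant).
   An idempotent of T_n of rank k kills Lambda^(k+1), hence the image of the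
   contraction of Lambda^(k+1), which is the kernel in Lambda^k, and it fixes
   v_1 /\ ... /\ v_k: so this kernel is superfluous.
   For 0 <> x in Lambda^k(Aug), some element of T_n of rank k + 1 sends x to a
   nonzero element, which is a multiple of the contraction of
   v_1 /\ ... /\ v_(k+1), a generator: so Lambda^k(Aug) is simple.
   An endomorphism of a minimal resolution lifting the identity is bijective in
   each degree, so it cannot factor through a shorter resolution. *)

Require Import Defs.
From HB Require Import structures.
From mathcomp Require Import all_boot all_order all_algebra all_fingroup.
From mathcomp Require Import boolp classical_sets reals complex.

Set Implicit Arguments.
Unset Strict Implicit.
Unset Printing Implicit Defensive.

Import GRing.Theory.
Local Open Scope ring_scope.
Local Open Scope classical_set_scope.

(** * Minimal resolutions and projective dimension *)
Section LinearRange.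
Variables (A : nzRingType) (M N : lmodType A) (g : {linear M -> N}).

Definition in_range : {pred N} := fun y => `[< exists x, g x = y >].

Lemma in_range_closed : submod_closed in_range.
Proof.
split=> [|a y z]; first by apply/asboolP; exists 0; rewrite linear0.
move=> /asboolP[x <-] /asboolP[x' <-]; apply/asboolP.
by exists (a *: x + x'); rewrite linearP.
Qed.

HB.instance Definition _ :=
  GRing.isSubmodClosed.Build A N in_range in_range_closed.

(** The image as a module of its own, because [projective_module] lifts only along maps onto a whole
    module. *)
Inductive range_mod : predArgType := RangeMod y & y \in in_range.
Definition range_val u := let: RangeMod y _ := u in y.
HB.instance Definition _ := [isSub of range_mod for range_val].
HB.instance Definition _ := [Choice of range_mod by <:].
HB.instance Definition _ := [SubChoice_isSubZmodule of range_mod by <:].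
HB.instance Definition _ := [SubZmodule_isSubLmodule of range_mod by <:].

Lemma range_in x : g x \in in_range.
Proof. by apply/asboolP; exists x. Qed.

Definition corange x : range_mod := RangeMod (range_in x).

Lemma corange_linear : linear corange.
Proof. by move=> a x y; apply: val_inj; rewrite /= linearP. Qed.

HB.instance Definition _ :=
  GRing.isLinear.Build A M range_mod *:%R corange corange_linear.

Lemma projective_lift (P : lmodType A) (f : {linear P -> N}) :
  projective_module P -> (forall p, range g (f p)) ->
  exists h : {linear P -> M}, forall p, g (h p) = f p.
Proof.
move=> projP fg.
have fin p : f p \in in_range by have [x _ <-] := fg p; apply: range_in.
pose f' p : range_mod := RangeMod (fin p).
have f'L : linear f' by move=> a x y; apply: val_inj; rewrite /= linearP.
pose f'M := GRing.isLinear.Build A P range_mod *:%R f' f'L.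
pose f'' : {linear P -> range_mod} := HB.pack f' f'M.
have [] := projP M range_mod corange f''.
  move=> [y yg]; have /asboolP[x gx] := yg.
  by exists x; apply: val_inj.
by move=> h hP; exists h => p; have /(congr1 val) := hP p.
Qed.

End LinearRange.

Section ProjectiveDimension.
Variable A : nzRingType.

(** Stands in for a finiteness condition: a composite of comparison maps that is onto is then
    bijective. *)
Definition hopfian (P : lmodType A) : Prop :=
  forall f : {linear P -> P}, range f = setT -> injective f.

(** Each [x] is [e y + (x - e y)] with the second term in the kernel of [f], so this kernel and the
    range of [e] span [M]. *)
Lemma superfluous_range (M N Q : lmodType A) (f : {linear M -> N})
    (e : {linear Q -> M}) :
    superfluous (kernel f) -> (forall x, exists y, f (e y) = f x) ->
  range e = setT.
Proof.
move=> sf fe; apply: sf => [|x].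
  split=> [|a u v]; first by exists 0; rewrite ?linear0.
  by move=> [y _ <-] [z _ <-]; exists (a *: y + z); rewrite ?linearP.
have [y fey] := fe x; exists (e y), (x - e y); split.
- by exists y.
- by rewrite /kernel /= linearB fey subrr.
- by rewrite addrC subrK.
Qed.

(* [F] and [G] are the components in one degree of maps, lifting the identity of
   a module, between two of its resolutions; [Z] and [Z'] are the cycles. *)
Definition comparable (X X' : lmodType A) (Z : set X) (Z' : set X') : Prop :=
  exists (F : {linear X -> X'}) (G : {linear X' -> X}),
    [/\ forall x, Z x -> Z' (F x), forall x, Z' x -> Z (G x),
        injective (fun x => G (F x))
      & forall x, Z x -> exists2 y, Z y & G (F y) = x].

Lemma comparable_step (X X' Y Y' : lmodType A) (Z : set X) (Z' : set X')
    (d : {linear Y -> X}) (d' : {linear Y' -> X'}) :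
    projective_module Y -> projective_module Y' ->
    range d = Z -> range d' = Z' -> superfluous (kernel d) -> hopfian Y ->
  comparable Z Z' -> comparable (kernel d) (kernel d').
Proof.
move=> pY pY' dZ dZ' sd hY [F [G [FZ GZ GFi GFs]]].
have Zd y : Z (d y) by rewrite -dZ; exists y.
have Zd' y : Z' (d' y) by rewrite -dZ'; exists y.
have [F1 F1P] : exists F1 : {linear Y -> Y'}, forall y, d' (F1 y) = F (d y).
  by apply: (projective_lift (f := F \o d)) => // p; rewrite dZ'; apply: FZ.
have [G1 G1P] : exists G1 : {linear Y' -> Y}, forall y, d (G1 y) = G (d' y).
  by apply: (projective_lift (f := G \o d')) => // p; rewrite dZ; apply: GZ.
have GF1s : range (G1 \o F1) = setT.
  apply: superfluous_range sd _ => x /=.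
  have [z Zz GFz] := GFs _ (Zd x); move: Zz; rewrite -dZ => -[y _ yz].
  by exists y; rewrite G1P F1P yz.
have GF1i := hY _ GF1s.
exists F1, G1; split=> [x|x|//|x].
- by rewrite /kernel /= F1P => ->; rewrite linear0.
- by rewrite /kernel /= G1P => ->; rewrite linear0.
rewrite /kernel /= => dx0.
have [y _ yx] : range (G1 \o F1) x by rewrite GF1s.
(* The preimage [y] of the cycle [x] is a cycle: the injective composite of [F] and [G] maps [d y]
   to [d x], which is 0. *)
exists y => //=; apply: GFi; rewrite /= -F1P -G1P; move: yx => /= ->.
by rewrite dx0 !linear0.
Qed.

Lemma minimal_resolution_length (M : lmodType A) (P : nat -> lmodType A)
    (eps : {linear P 0%N -> M}) (d : forall q, {linear P q.+1 -> P q})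
    (l : nat) :
    minimal_projective_resolution eps d -> (forall q, hopfian (P q)) ->
    (exists x : P l, x <> 0) ->
  forall l', has_resolution_of_length M l' -> (l <= l')%N.
Proof.
move=> [[pP eps_s d0 dS] [_ _ seps] sd] hP [x0 x0n0] l'.
move=> [P' [eps' [d' [[pP' eps'_s d'0 d'S] P'0]]]].
rewrite leqNgt; apply/negP => /P'0 P'l0.
pose Z q : set (P q) :=
  if q is q.+1 return set (P q) then kernel (d q) else kernel eps.
pose Z' q : set (P' q) :=
  if q is q.+1 return set (P' q) then kernel (d' q) else kernel eps'.
have dZ q : range (d q) = Z q by case: q.
have dZ' q : range (d' q) = Z' q by case: q.
have : comparable (Z l) (Z' l).
  elim: (l) => [|q IH].
    (* Degree -1 is [M] with the identity, where every element counts as a cycle. *)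
    apply: (comparable_step (pP 0%N) (pP' 0%N) eps_s eps'_s seps (hP 0%N)).
    by exists idfun, idfun; split=> // x _; exists x.
  have [_ _ sq] := sd q.
  exact: comparable_step (pP _) (pP' _) (dZ q) (dZ' q) sq (hP _) IH.
(* An injective endomorphism of [P l] factors through the zero module [P' l]. *)
move=> [F [G [_ _ GFi _]]]; apply: x0n0; apply: GFi.
by rewrite (P'l0 (F x0)) !linear0.
Qed.

Lemma has_resolution_iso (M N : lmodType A) (f : {linear M -> N})
    (g : {linear N -> M}) l :
    cancel f g -> cancel g f ->
  has_resolution_of_length M l -> has_resolution_of_length N l.
Proof.
move=> fK gK [P [eps [d [[pP eps_s d0 dS] P0]]]].
exists P, (f \o eps), d; split=> //; split=> //.
  rewrite -subTset => y _; have [x _ xy] : range eps (g y) by rewrite eps_s.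
  by exists x => //=; rewrite xy gK.
rewrite d0; apply/seteqP; split=> x; rewrite /kernel /=.
  by move=> ->; rewrite linear0.
by move=> /(congr1 g); rewrite fK linear0.
Qed.

Lemma projective_dimension_iso (M N : lmodType A) (f : {linear M -> N})
    (g : {linear N -> M}) l :
    cancel f g -> cancel g f ->
  projective_dimension_is M l -> projective_dimension_is N l.
Proof.
move=> fK gK [resM minM]; split; first exact: has_resolution_iso fK gK resM.
by move=> l' /(has_resolution_iso gK fK); apply: minM.
Qed.

End ProjectiveDimension.

(** [theta] splits the map sending [a] to [a *: x0], so [P] is a retract of the free module of rank
    one. *)
Lemma projective_retract (A : nzRingType) (P : lmodType A)
    (theta : {linear P -> A^o}) (x0 : P) :
  (forall x, (theta x : A) *: x0 = x) -> projective_module P.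
Proof.
move=> thetaK M N g f g_s; have [m gm] := g_s (f x0).
pose h (x : P) : M := (theta x : A) *: m.
have hL : linear h.
  by move=> a x y; rewrite /h linearP scalerDl -scalerA.
pose hM := GRing.isLinear.Build A P M *:%R h hL.
pose h' : {linear P -> M} := HB.pack h hM.
by exists h' => x; rewrite linearZ /= gm -linearZ thetaK.
Qed.

(** * Contractions of exterior powers *)

(* keeps [/=] from unfolding the bundled linear maps, here and below *)
#[local] Opaque extpow_map.

Section Wedge.
Variables (F : fieldType).

(** Passing from [u] to [u'] multiplies the coordinate matrices on the left by [C], and determinants
    are multiplicative. *)
Lemma wedge_comb k (V : vectType F) (C : 'M[F]_k) (u u' : {ffun 'I_k -> V}) :
  (forall i, u' i = \sum_j C i j *: u j) -> wedge u' = \det C *: wedge u.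
Proof.
move=> uE; apply/ffunP=> g; rewrite !ffunE -[RHS]det_mulmx; congr (\det _).
apply/matrixP=> i j; rewrite !mxE uE linear_sum; apply: eq_bigr => l _.
by rewrite linearZ !mxE.
Qed.

Lemma wedge_perm k (V : vectType F) (u : {ffun 'I_k -> V}) (s : 'S_k) :
  wedge [ffun i => u (s i)] = (-1) ^+ s *: wedge u.
Proof.
rewrite -det_perm; apply: wedge_comb => i; rewrite ffunE (bigD1 (s i)) //=.
rewrite !mxE eqxx scale1r big1 ?addr0 // => j /negPf sj.
by rewrite !mxE eq_sym sj scale0r.
Qed.

(* Transporting along the linear map that sends [vbasis {:V}] to [c] reduces the
   statement to [altmult_eq0]. *)
Lemma extpow_linear_eq_basis k m (V : vectType F) (W : lmodType F)
    (c : 'I_m -> V) (f g : {linear extpow k V -> W}) :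
    m = \dim {:V} ->
    (forall x, exists a : 'I_m -> F, x = \sum_i a i *: c i) ->
    (forall h : incseq k m, f (wedge [ffun j => c (val h j)]) =
       g (wedge [ffun j => c (val h j)])) ->
  f =1 g.
Proof.
move=> mV; subst m => c_span fg.
pose T (x : V) : V := \sum_i coord (vbasis {:V}) i x *: c i.
have TL : linear T.
  move=> a x y; rewrite scaler_sumr -big_split; apply: eq_bigr => i _.
  by rewrite linearP scalerDl scalerA.
have Tb (i : 'I_(\dim {:V})) : T (vbasis {:V})`_i = c i.
  rewrite /T (bigD1 i) //= big1 => [|j /negPf ji].
    by rewrite coord_free ?(basis_free (vbasisP _)) // eqxx scale1r addr0.
  by rewrite coord_free ?(basis_free (vbasisP _)) // eq_sym ji scale0r.
pose TM := GRing.isLinear.Build F V V *:%R T TL.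
pose T' : {linear V -> V} := HB.pack T TM.
have T_s x : exists y, T y = x.
  have [a ->] := c_span x; exists (\sum_i a i *: (vbasis {:V})`_i).
  rewrite -[T _]/(T' _) linear_sum; apply: eq_bigr => i _.
  by rewrite linearZ /= Tb.
have fgT : (f \o extpow_map k T') =1 (g \o extpow_map k T').
  move=> x; rewrite (extpow_sum x) !linear_sum; apply: eq_bigr => h _.
  rewrite !linearZ /= extpow_map_wedge; congr (_ *: _).
  have -> : [ffun i => T' ([ffun i0 => (vbasis {:V})`_(val h i0)] i)]
    = [ffun j => c (val h j)] by apply/ffunP=> i; rewrite !ffunE [LHS]Tb.
  exact: fg.
apply: extpow_linear_eq => u.
have [v vP] := fin_all_exists (fun i => T_s (u i)).
have := fgT (wedge (finfun v)); rewrite /= extpow_map_wedge.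
suff -> : [ffun i => T' (finfun v i)] = u by [].
by apply/ffunP=> i; rewrite !ffunE [LHS]vP.
Qed.

Section Contraction.
Variables (V : vectType F) (phi : {linear V -> F^o}).

(* Contracting in the last slot amounts to adding [phi] as a last column to the
   matrices whose determinants are the coordinates of a wedge. *)
Definition contr_mx k (u : {ffun 'I_k.+1 -> V}) (g : incseq k (\dim {:V}))
    : 'M[F]_k.+1 :=
  \matrix_(i, j) if unlift ord_max j is Some l
                 then coord (vbasis {:V}) (val g l) (u i) else phi (u i).

Definition contr k (u : {ffun 'I_k.+1 -> V}) : extpow k V :=
  [ffun g => \det (contr_mx u g)].

Lemma contr_multilinear k : multilinear (@contr k).
Proof.
move=> u i a x y; apply/ffunP=> g; rewrite !ffunE /GRing.scale /=.
rewrite -[X in _ = _ + X]mul1r.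
apply: (determinant_multilinear (i0 := i)).
- apply/rowP=> j; rewrite !mxE !ffunE eqxx mul1r.
  by case: unlift => [l|]; rewrite linearP.
- by apply/matrixP=> l j; rewrite !mxE !ffunE eq_sym (negPf (neq_lift _ _)).
- by apply/matrixP=> l j; rewrite !mxE !ffunE eq_sym (negPf (neq_lift _ _)).
Qed.

Lemma contr_alternating k : alternating (@contr k).
Proof.
move=> u i j ij uij; apply/ffunP=> g; rewrite !ffunE.
by apply: (determinant_alternate ij) => l; rewrite !mxE uij.
Qed.

(** Laplace expansion along the column of values of [phi]. *)
Lemma contrE k (u : {ffun 'I_k.+1 -> V}) :
  contr u = \sum_(i < k.+1) ((-1) ^+ (i + k) * phi (u i)) *:
    wedge [ffun j => u (lift i j)].
Proof.
apply/ffunP=> g; rewrite sum_ffunE ffunE (expand_det_col _ ord_max).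
apply: eq_bigr => i _.
rewrite !ffunE !mxE unlift_none /cofactor /GRing.scale /=.
rewrite mulrA [_ * (-1) ^+ _]mulrC; congr (_ * \det _).
by apply/matrixP=> l j; rewrite !mxE liftK ffunE.
Qed.

Definition contraction k : {linear extpow k.+1 V -> extpow k V} :=
  extpow_lift (@contr k).
#[local] Opaque contraction.

Lemma contraction_wedge k (u : {ffun 'I_k.+1 -> V}) :
  contraction k (wedge u) = \sum_(i < k.+1) ((-1) ^+ (i + k) * phi (u i)) *:
    wedge [ffun j => u (lift i j)].
Proof.
rewrite -contrE; apply: (extpow_lift_wedge (phi := @contr k)).
  exact: contr_multilinear.
exact: contr_alternating.
Qed.

End Contraction.

Lemma contraction_map k (V W : vectType F) (phi : {linear V -> F^o})
    (psi : {linear W -> F^o}) (f : {linear V -> W}) :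
    (forall x, psi (f x) = phi x) ->
  forall x, contraction psi k (extpow_map k.+1 f x) =
    extpow_map k f (contraction phi k x).
Proof.
move=> psif; apply: (@extpow_linear_eq _ _ _ _
  (contraction psi k \o extpow_map k.+1 f)
  (extpow_map k f \o contraction phi k)) => u /=.
rewrite extpow_map_wedge !contraction_wedge linear_sum; apply: eq_bigr => i _.
rewrite linearZ extpow_map_wedge ffunE psif; congr (_ *: wedge _).
by apply/ffunP=> j; rewrite !ffunE.
Qed.

Section WedgeRight.
Variables (V : vectType F) (w : V).

(** [w] is appended last, in the slot where the contraction carries the sign +1. *)
Definition ffrcons k (u : {ffun 'I_k -> V}) : {ffun 'I_k.+1 -> V} :=
  [ffun i => if unlift ord_max i is Some j then u j else w].

Definition wedge_right k : {linear extpow k V -> extpow k.+1 V} :=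
  extpow_lift (fun u => wedge (ffrcons u)).
#[local] Opaque wedge_right.

Lemma wedge_right_wedge k (u : {ffun 'I_k -> V}) :
  wedge_right k (wedge u) = wedge (ffrcons u).
Proof.
apply: extpow_lift_wedge => {u} [u i a x y|u i j ij uij].
  have upd z : ffrcons (ffupd u i z) = ffupd (ffrcons u) (lift ord_max i) z.
    apply/ffunP=> j; rewrite !ffunE; case: unliftP => [l|] ->.
      by rewrite ffunE (inj_eq lift_inj).
    by rewrite (negPf (neq_lift _ _)).
  by rewrite !upd wedge_multilinear.
apply: (@wedge_alternating _ _ _ _ (lift ord_max i) (lift ord_max j)).
  by rewrite (inj_eq lift_inj).
by rewrite !ffunE !liftK.
Qed.

End WedgeRight.

(** * Contraction by a form dual to the last vector of a basis *)

Section DualBasis.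
Variables (n : nat) (V : vectType F) (c : 'I_n -> V) (l : 'I_n).
Variable phi : {linear V -> F^o}.
Hypotheses (dimV : n = \dim {:V})
  (c_span : forall x, exists a : 'I_n -> F, x = \sum_i a i *: c i)
  (l_max : forall i : 'I_n, (i <= l)%N)
  (phi_c : forall i, phi (c i) = (i == l)%:R).

Lemma incseq_lt k (g : incseq k n) (i j : 'I_k) :
  (i < j)%N -> (val g i < val g j)%N.
Proof. by case: g => g /= /forallP/(_ i)/forallP/(_ j)/implyP. Qed.

(** Only the last entry of an increasing sequence can be the top index [l]; this kills all but one
    term of a contraction. *)
Lemma incseq_neq_last k (g : incseq k.+1 n) (i : 'I_k.+1) :
  i != ord_max -> val g i != l.
Proof.
move=> i_max; have /(incseq_lt g) gi : (i < (ord_max : 'I_k.+1))%N.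
  by rewrite ltn_neqAle -ltnS ltn_ord andbT.
by rewrite neq_ltn (leq_trans gi (l_max _)).
Qed.

Lemma contraction_basis k (g : incseq k.+1 n) :
  contraction phi k (wedge [ffun j => c (val g j)]) =
  if val g ord_max == l then wedge [ffun j => c (val g (lift ord_max j))]
  else 0.
Proof.
rewrite contraction_wedge (bigD1 ord_max) //= [X in _ + X]big1 => [|i i_max].
  rewrite addr0 -signr_odd oddD addbb mul1r ffunE phi_c.
  case: ifP => _; last by rewrite scale0r.
  by rewrite scale1r; congr wedge; apply/ffunP=> j; rewrite !ffunE.
by rewrite ffunE phi_c (negPf (incseq_neq_last _ i_max)) mulr0 scale0r.
Qed.

(** On a basis wedge one summand returns the wedge and the other vanishes, according to whether the
    last factor is [c l]. *)
Lemma contraction_homotopy k (x : extpow k.+1 V) :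
  wedge_right (c l) k (contraction phi k x) +
  contraction phi k.+1 (wedge_right (c l) k.+1 x) = x.
Proof.
apply: (@extpow_linear_eq_basis _ _ _ _ c
  ((wedge_right (c l) k \o contraction phi k) \+
   (contraction phi k.+1 \o wedge_right (c l) k.+1)) idfun) => // g /=.
rewrite contraction_basis wedge_right_wedge; case: eqP => gl.
  rewrite wedge_right_wedge [X in _ + X = _](_ : _ = 0).
    rewrite addr0; congr wedge; apply/ffunP=> i; rewrite !ffunE.
    by case: unliftP => [j|] ->; rewrite ?ffunE ?gl.
  (* Appending [c l] to a wedge that already ends in [c l] repeats a factor. *)
  rewrite (_ : wedge _ = 0) ?linear0 //.
  apply: (@wedge_alternating _ _ _ _ (lift ord_max ord_max) ord_max).
    by rewrite eq_sym neq_lift.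
  by rewrite !ffunE liftK unlift_none ffunE gl.
(* Without [c l] in the wedge, [phi] is nonzero only on the appended factor, whose removal restores
   the wedge. *)
rewrite linear0 add0r contraction_wedge (bigD1 ord_max) //=.
rewrite [X in _ + X]big1 => [|i i_max].
  rewrite addr0 -signr_odd oddD addbb mul1r ffunE unlift_none phi_c eqxx.
  rewrite scale1r.
  by congr wedge; apply/ffunP=> j; rewrite !ffunE liftK ffunE.
rewrite ffunE; case: unliftP i_max => [j _|->]; last by rewrite eqxx.
rewrite ffunE phi_c => _.
suff /negPf-> : val g j != l by rewrite mulr0 scale0r.
case: (eqVneq j ord_max) => [->|]; first exact/eqP.
exact: incseq_neq_last.
Qed.

(** A contraction is a combination of wedges of the [c i] with [i != l], and [j] after [p] fixes
    these vectors. *)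
Lemma contraction_project k (U : vectType F) (p : {linear V -> U})
    (j : {linear U -> V}) (x : extpow k.+1 V) :
    (forall i, i != l -> j (p (c i)) = c i) ->
  extpow_map k j (extpow_map k p (contraction phi k x)) = contraction phi k x.
Proof.
move=> jp; move: x; apply: (@extpow_linear_eq_basis _ _ _ _ c
  (extpow_map k j \o (extpow_map k p \o contraction phi k))
  (contraction phi k)) => // g /=.
rewrite contraction_basis; case: eqP => gl; last by rewrite !linear0.
rewrite !extpow_map_wedge; congr wedge; apply/ffunP=> i; rewrite !ffunE.
by rewrite jp // incseq_neq_last // eq_sym neq_lift.
Qed.

End DualBasis.

Lemma contraction_ker k (U V : vectType F) (phi : {linear V -> F^o})
    (j : {linear U -> V}) (x : extpow k.+1 U) :
  (forall y, phi (j y) = 0) -> contraction phi k (extpow_map k.+1 j x) = 0.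
Proof.
move=> phij; move: x; apply: (@extpow_linear_eq _ _ _ _
  (contraction phi k \o extpow_map k.+1 j) \0) => u /=.
rewrite extpow_map_wedge contraction_wedge big1 // => i _.
by rewrite ffunE phij mulr0 scale0r.
Qed.

Lemma contraction_wedge_right k (U V : vectType F) (phi : {linear V -> F^o})
    (j : {linear U -> V}) w (x : extpow k U) :
    (forall y, phi (j y) = 0) -> phi w = 1 ->
  contraction phi k (wedge_right w k (extpow_map k j x)) = extpow_map k j x.
Proof.
move=> phij phiw; move: x; apply: (@extpow_linear_eq _ _ _ _
  (contraction phi k \o (wedge_right w k \o extpow_map k j))
  (extpow_map k j)) => u /=.
rewrite extpow_map_wedge wedge_right_wedge contraction_wedge.
rewrite (bigD1 ord_max) //=.
rewrite [X in _ + X]big1 => [|i i_max].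
  rewrite addr0 -signr_odd oddD addbb mul1r ffunE unlift_none phiw scale1r.
  by congr wedge; apply/ffunP=> i; rewrite !ffunE liftK ffunE.
rewrite ffunE; case: unliftP i_max => [i' _|->]; last by rewrite eqxx.
by rewrite ffunE phij mulr0 scale0r.
Qed.

Lemma extpow_mapK k (U V : vectType F) (f : {linear U -> V})
    (g : {linear V -> U}) :
  cancel f g -> cancel (extpow_map k f) (extpow_map k g).
Proof.
move=> fK; apply: (@extpow_linear_eq _ _ _ _
  (extpow_map k g \o extpow_map k f) idfun) => u /=.
rewrite !extpow_map_wedge; congr wedge; apply/ffunP=> i.
by rewrite !ffunE fK.
Qed.

End Wedge.
#[local] Opaque contraction wedge_right.

(** * Modules of representations of the transformation monoid *)
Section TMod.
Variables (F : fieldType) (n : nat).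
Local Notation A := (transf_alg F n).
Local Notation W := {ffun transf n -> F^o}.

Lemma tmod_linear (V1 V2 : trep F n) (f : {linear V1 -> V2}) :
    (forall t x, f (trep_act V1 t x) = trep_act V2 t (f x)) ->
  linear (f : tmod V1 -> tmod V2).
Proof.
move=> fV a x y; rewrite [LHS]linearD; congr (_ + _).
rewrite [LHS]linear_sum; apply: eq_bigr => t _.
by rewrite linearZ /= fV.
Qed.

Definition tmod_hom (V1 V2 : trep F n) (f : {linear V1 -> V2})
    (fV : forall t x, f (trep_act V1 t x) = trep_act V2 t (f x))
    : {linear tmod V1 -> tmod V2} :=
  HB.pack (f : tmod V1 -> tmod V2)
    (GRing.isLinear.Build A (tmod V1) (tmod V2) *:%R _ (tmod_linear fV)).

Section Scalars.
Variable V : trep F n.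

(** [W] is [A] seen as a vector space over [F], so that the action is [F]-linear in the algebra
    element. *)
Definition tmod_eval (x : V) (a : W) : V := (a : A) *: (x : tmod V).

Lemma tmod_eval_linear x : linear (tmod_eval x).
Proof.
move=> c a b; rewrite scaler_sumr -big_split; apply: eq_bigr => f _.
by rewrite !ffunE scalerDl scalerA.
Qed.
HB.instance Definition _ x :=
  GRing.isLinear.Build F W V *:%R (tmod_eval x) (tmod_eval_linear x).

(** [F] acts through the multiples of the unit of [A], so [A]-linear maps are [F]-linear. *)
Lemma tmod_scale_const (c : F) (x : V) :
  tmod_eval x (c *: ((1%R : A) : W)) = c *: x.
Proof. by rewrite linearZ /=; congr (_ *: _); apply: tmod_scale1. Qed.

(** Such a map is [F]-linear on a finite dimensional space, so rank and nullity decide. *)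
Lemma tmod_hopfian : hopfian (tmod V).
Proof.
move=> f f_s; have fL : linear (f : V -> V).
  by move=> c x y; rewrite -!tmod_scale_const [LHS]linearP.
pose fM := GRing.isLinear.Build F V V *:%R (f : V -> V) fL.
pose g : {linear V -> V} := HB.pack (f : V -> V) fM.
have /lker0P g_inj : lker (linfun g) == 0%VS.
  rewrite -dimv_eq0; have := limg_ker_dim (linfun g) fullv; rewrite capfv.
  suff -> : (linfun g @: fullv)%VS = fullv.
    by move=> /eqP; rewrite -[X in _ == X]add0n eqn_add2r.
  apply/vspaceP => y; rewrite memvf; have [x _ xy] : range f y by rewrite f_s.
  by apply/memv_imgP; exists x; rewrite ?memvf // lfunE.
by move=> x y fxy; apply: g_inj; rewrite !lfunE.
Qed.

End Scalars.

Lemma talg_ofM (f : transf n) (b : A) h :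
  (talg_of F f * b) h = \sum_g b g * (h == (f * g)%g)%:R.
Proof.
rewrite [LHS]talg_mulE (bigD1 f) //= [X in _ + X]big1 => [|g /negPf gf].
  by rewrite addr0; apply: eq_bigr => g _; rewrite ffunE eqxx mul1r.
by rewrite big1 // => g' _; rewrite ffunE gf !mul0r.
Qed.

Lemma talg_of_mul (f g : transf n) :
  talg_of F f * talg_of F g = talg_of F (f * g)%g :> A.
Proof.
apply/ffunP=> h; rewrite talg_ofM ffunE (bigD1 g) //= big1 => [|g' /negPf gg'].
  by rewrite addr0 ffunE eqxx mul1r.
by rewrite ffunE gg' mul0r.
Qed.

Definition talg_translate (f : transf n) (b : W) : W := (talg_of F f : A) * b.

Lemma talg_translate_linear f : linear (talg_translate f).
Proof.
move=> c a b; apply/ffunP=> h; rewrite [RHS]ffunE [X in _ = X + _]ffunE.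
rewrite !talg_ofM [X in _ = X + _]mulr_sumr -big_split; apply: eq_bigr => g _.
by rewrite !ffunE mulrDl -mulrA.
Qed.
HB.instance Definition _ f :=
  GRing.isLinear.Build F W W *:%R (talg_translate f) (talg_translate_linear f).

Lemma talg_mul_sumE (a b : A) :
  a * b = \sum_f (a f *: talg_translate f b) :> W.
Proof.
apply/ffunP=> h; rewrite sum_ffunE [LHS]talg_mulE; apply: eq_bigr => f _.
rewrite ffunE talg_ofM [RHS]mulr_sumr.
by apply: eq_bigr => g _; rewrite mulrA.
Qed.

End TMod.

(** * Exterior powers of the natural module *)
Section NaturalModule.
Variables (F : fieldType) (n : nat).
Local Notation V := 'rV[F]_n.
Local Notation A := (transf_alg F n).
Local Notation W := {ffun transf n -> F^o}.
Local Notation act k f := (trep_act (extrep k (natrep F n)) f).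

Definition vwedge k (a : {ffun 'I_k -> 'I_n}) : extpow k V :=
  wedge [ffun j => vvec F (a j)].

Lemma act_wedge k f (u : {ffun 'I_k -> V}) :
  act k f (wedge u) = wedge [ffun i => nat_act f (u i)].
Proof. exact: extrep_wedge. Qed.

Lemma act_vwedge k f (a : {ffun 'I_k -> 'I_n}) :
  act k f (vwedge a) = vwedge [ffun j => f (a j)].
Proof.
rewrite act_wedge; congr wedge; apply/ffunP=> j.
by rewrite !ffunE nat_act_delta.
Qed.

Lemma vwedge_perm k (a : {ffun 'I_k -> 'I_n}) (s : 'S_k) :
  vwedge [ffun j => a (s j)] = (-1) ^+ s *: vwedge a.
Proof.
rewrite -wedge_perm; congr wedge; apply/ffunP=> j.
by rewrite !ffunE.
Qed.

Lemma dim_rV : n = \dim {:V}.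
Proof. by rewrite dimvf /dim /= mul1n. Qed.

Lemma extpow_linear_eq_vwedge k (U : lmodType F)
    (f g : {linear extpow k V -> U}) :
  (forall a, f (vwedge a) = g (vwedge a)) -> f =1 g.
Proof.
move=> fg; apply: (extpow_linear_eq_basis (c := @vvec F n) dim_rV) => [x|h].
  by exists (fun i => x 0 i); rewrite [LHS]row_sum_delta.
exact: fg.
Qed.

Definition minor k (t : {ffun 'I_k -> 'I_n}) (u : {ffun 'I_k -> V}) : F^o :=
  \det (\matrix_(i, j) u i 0 (t j)).

(** All [t] are allowed, not only increasing ones, so that sums over [t] are compatible with the
    action without sorting. *)
Definition vcoef k (t : {ffun 'I_k -> 'I_n}) : {linear extpow k V -> F^o} :=
  extpow_lift (minor t).
#[local] Opaque vcoef.

Lemma vcoef_wedge k t (u : {ffun 'I_k -> V}) :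
  vcoef t (wedge u) = \det (\matrix_(i, j) u i 0 (t j)).
Proof.
apply: (extpow_lift_wedge (phi := minor t)) => {u} [u i a x y|u i j ij uij].
  rewrite -[X in _ = _ + X]mul1r.
  apply: (determinant_multilinear (i0 := i)).
  - by apply/rowP=> j; rewrite !mxE !ffunE eqxx mul1r !mxE.
  - by apply/matrixP=> l j; rewrite !mxE !ffunE eq_sym (negPf (neq_lift _ _)).
  - by apply/matrixP=> l j; rewrite !mxE !ffunE eq_sym (negPf (neq_lift _ _)).
by apply: (determinant_alternate ij) => l; rewrite !mxE uij.
Qed.

Lemma vcoef_alternating k (t : {ffun 'I_k -> 'I_n}) x :
  vcoef t x != 0 -> injective t.
Proof.
move=> tx; apply/injectiveP; apply: contraNT tx => /injectivePn[i [j ij tij]].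
apply/eqP; move: x; apply: (@extpow_linear_eq _ _ _ _ (vcoef t) \0) => u /=.
rewrite vcoef_wedge -det_tr; apply: (determinant_alternate ij) => l.
by rewrite !mxE tij.
Qed.

(** By the Leibniz formula, the minor at [t] of the vectors [v_(a_i)] is a signed count of the
    permutations [s] with [t] equal to [a] after [s]. *)
Lemma sum_vcoef_vwedge (U : lmodType F) k (G : {ffun 'I_k -> 'I_n} -> U) a :
  \sum_t vcoef t (vwedge a) *: G t =
  \sum_(s : 'S_k) (-1) ^+ s *: G [ffun j => a (s j)].
Proof.
transitivity (\sum_(t : {ffun 'I_k -> 'I_n}) \sum_(s : 'S_k)
    ((t == [ffun j => a (s j)])%:R * (-1) ^+ s) *: G t).
  apply: eq_bigr => t _; rewrite -scaler_suml; congr (_ *: _).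
  rewrite vcoef_wedge -det_tr; apply: eq_bigr => s _; rewrite mulrC.
  congr (_ * _); case: eqP => [->|ne].
    by rewrite big1 // => i _; rewrite !mxE !ffunE mxE !eqxx.
  have [i ti] : exists i, t i <> a (s i).
    apply: contrapT => /forallNP H; apply: ne; apply/ffunP=> i.
    by rewrite ffunE; apply: contrapT => /H.
  rewrite (bigD1 i) //= !mxE ffunE mxE eqxx /=.
  by case: eqP => [//|]; rewrite mul0r.
rewrite exchange_big /=; apply: eq_bigr => s _.
rewrite (bigD1 [ffun j => a (s j)]) //= eqxx mul1r big1 ?addr0 // => t /negPf->.
by rewrite mul0r scale0r.
Qed.

(** On a wedge of basis vectors each of the [k!] reorderings contributes its sign twice. *)
Lemma vcoef_sum k (x : extpow k V) :
  \sum_t vcoef t x *: vwedge t = (k`!)%:R *: x.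
Proof.
have fL : linear (fun x : extpow k V => \sum_t vcoef t x *: vwedge t).
  move=> c y z; rewrite scaler_sumr -big_split; apply: eq_bigr => t _.
  by rewrite linearP scalerDl scalerA.
pose fM := GRing.isLinear.Build F (extpow k V) (extpow k V) *:%R _ fL.
move: x; apply: (@extpow_linear_eq_vwedge _ _ (HB.pack (fun x : extpow k V =>
  \sum_t vcoef t x *: vwedge t : extpow k V) fM) ((k`!)%:R \*: idfun)) => a /=.
rewrite sum_vcoef_vwedge.
under eq_bigr do rewrite vwedge_perm scalerA -expr2 sqrr_sign scale1r.
by rewrite sumr_const card_Sn -scaler_nat.
Qed.

(** For [i > k], [inord] returns the index 0, so the extension takes no values outside those of
    [t]. *)
Definition extend k (t : {ffun 'I_k.+1 -> 'I_n}) : transf n :=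
  [ffun i : 'I_n => t (inord i)].

Lemma extend_comp k f (t : {ffun 'I_k.+1 -> 'I_n}) :
  (f * extend t)%g = extend [ffun j => f (t j)].
Proof. by apply/ffunP=> i; rewrite transfM !ffunE. Qed.

Definition vcover_sum k (x : extpow k.+1 V) : W :=
  \sum_t vcoef t x *: (talg_of F (extend t) : W).

Lemma vcover_sum_linear k : linear (@vcover_sum k).
Proof.
move=> c y z; rewrite scaler_sumr -big_split; apply: eq_bigr => t _.
by rewrite linearP scalerDl scalerA.
Qed.
HB.instance Definition _ k :=
  GRing.isLinear.Build F (extpow k.+1 V) W *:%R (@vcover_sum k)
    (@vcover_sum_linear k).

(** Acting by [f] replaces [t] by [f] after [t], both in the wedge and, by [extend_comp], in the
    monoid. *)
Lemma vcover_sum_act k f (x : extpow k.+1 V) :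
  vcover_sum (act k.+1 f x) = talg_translate f (vcover_sum x).
Proof.
move: x; apply: (@extpow_linear_eq_vwedge _ _ (@vcover_sum k \o act k.+1 f)
  (talg_translate f \o @vcover_sum k)) => a /=.
rewrite act_vwedge /vcover_sum !sum_vcoef_vwedge linear_sum.
apply: eq_bigr => s _; rewrite linearZ /=; congr (_ *: _).
rewrite /talg_translate talg_of_mul extend_comp; congr (talg_of _ (extend _)).
by apply/ffunP=> j; rewrite !ffunE.
Qed.

Definition vcover k (x : tmod (extrep k.+1 (natrep F n))) : A^o :=
  (k.+1`!%:R)^-1 *: vcover_sum x : W.

Lemma vcover_linear k : linear (@vcover k).
Proof.
move=> a x y; rewrite /vcover [vcover_sum _]linearD scalerDr; congr (_ + _).
(* [A] and [W] are convertible; the [transitivity] steps select which scalar action is meant. *)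
transitivity ((a : A) * ((k.+1`!%:R)^-1 *: vcover_sum x : W)) => //.
rewrite talg_mul_sumE.
transitivity ((k.+1`!%:R)^-1 *: vcover_sum (\sum_f a f *: act k.+1 f x)) => //.
rewrite [vcover_sum _]linear_sum scaler_sumr; apply: eq_bigr => f _.
have sZ c z : @vcover_sum k (c *: z) = c *: vcover_sum z by rewrite linearZ.
have tZ c z : talg_translate f (c *: z) = c *: talg_translate f z :> W.
  by rewrite linearZ.
transitivity ((k.+1`!%:R)^-1 *: vcover_sum (a f *: act k.+1 f x)) => //.
by rewrite sZ vcover_sum_act tZ [LHS]scalerA [RHS]scalerA mulrC.
Qed.
HB.instance Definition _ k :=
  GRing.isLinear.Build A (tmod (extrep k.+1 (natrep F n))) A^o *:%R (@vcover k)
    (@vcover_linear k).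

Section Generator.
Variables (k : nat) (hk : (k <= n)%N).

Definition vstd : {ffun 'I_k -> 'I_n} := [ffun j => widen_ord hk j].

Lemma vwedge_vstd_neq0 : vwedge vstd <> 0.
Proof.
move=> v0; have /eqP := congr1 (vcoef vstd) v0; rewrite linear0 vcoef_wedge.
rewrite (_ : (\matrix_(i, j) _) = 1%:M) ?det1 ?oner_eq0 //.
apply/matrixP=> i j; rewrite !mxE !ffunE mxE eqxx /=.
by rewrite [in RHS]eq_sym -!val_eqE.
Qed.

(** All [f u_i] are combinations of the [k] vectors [v_1], ..., [v_k]. *)
Lemma act_rank_det (f : transf n) (h : 'I_n -> 'I_k) :
    (forall i, f i = widen_ord hk (h i)) ->
  forall x : extpow k V, exists c, act k f x = c *: vwedge vstd.
Proof.
move=> fh x; rewrite (extpow_sum x) linear_sum.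
elim/big_rec: _ => [|g y _ [c ->]]; first by exists 0; rewrite scale0r.
rewrite linearZ /=; set u := [ffun _ => _]; rewrite act_wedge.
(* Entry [(i, m)] sums the coordinates of [u i] over the fibre of [h] at [m]. *)
rewrite (_ : wedge _ = \det (\matrix_(i, m)
    \sum_(l | h l == m) u i 0 l) *: vwedge vstd).
  by rewrite scalerA -scalerDl; eexists.
apply: wedge_comb => i; rewrite ffunE /nat_act.
rewrite (partition_big h predT) //=; apply: eq_bigr => m _.
rewrite mxE scaler_suml; apply: eq_bigr => l /eqP hl.
by rewrite fh hl; congr (_ *: _); rewrite [RHS]ffunE /vvec ffunE.
Qed.

End Generator.

(** By the pigeonhole principle, [f] makes two factors of every wedge of basis vectors equal. *)
Lemma act_rank_lt k m (hm : (m <= n)%N) (f : transf n) (h : 'I_n -> 'I_m) :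
    (m < k)%N -> (forall i, f i = widen_ord hm (h i)) ->
  forall x, act k f x = 0.
Proof.
move=> mk fh; apply: (@extpow_linear_eq_vwedge _ _ (act k f) \0) => a /=.
rewrite act_vwedge; have : ~ injective (h \o a).
  by move=> /leq_card; rewrite !card_ord leqNgt mk.
move=> /injectiveP/injectivePn[i [j ij /= hij]].
by apply: (wedge_alternating ij); rewrite !ffunE !fh hij.
Qed.

Section CharZero.
Hypothesis F0 : [pchar F] =i pred0.

Lemma fact_neq0 k : (k`!)%:R != 0 :> F.
Proof. by have /pcharf0P-> := F0; rewrite -lt0n fact_gt0. Qed.

Lemma vcoef_neq0 k (x : extpow k V) : x <> 0 -> exists t, vcoef t x != 0.
Proof.
move=> x0; apply: contrapT => /forallNP t0; apply: x0; apply/eqP.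
have /eqP : (k`!)%:R *: x = 0.
  rewrite -vcoef_sum big1 // => t _; have /negP := t0 t.
  by rewrite negbK => /eqP->; rewrite scale0r.
by rewrite scaler_eq0 (negPf (fact_neq0 k)).
Qed.

(** [extend t] carries the standard wedge to [vwedge t], which turns the sum into that of
    [vcoef_sum]. *)
Lemma vcoverK k (hk : (k.+1 <= n)%N) (x : tmod (extrep k.+1 (natrep F n))) :
  (vcover x : A) *: (vwedge (vstd hk) : tmod (extrep k.+1 (natrep F n))) = x.
Proof.
pose x0 : extrep k.+1 (natrep F n) := vwedge (vstd hk).
have xE : tmod_eval x0 (vcover_sum x) = (k.+1`!)%:R *: (x : extpow k.+1 V).
  rewrite -vcoef_sum [LHS]linear_sum; apply: eq_bigr => t _; rewrite linearZ /=.
  congr (_ *: _); rewrite /tmod_eval tmod_ofE act_vwedge; congr vwedge.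
  by apply/ffunP=> j; rewrite !ffunE /= inord_val.
rewrite -[LHS]/(tmod_eval x0 ((k.+1`!%:R)^-1 *: vcover_sum x)).
by rewrite linearZ /= xE [LHS]scalerA mulVf ?fact_neq0 // [LHS]scale1r.
Qed.

(** An increasing sequence is injective, so none of length [k] exists and there are no
    coordinates. *)
Lemma extpow_natrep_eq0 k (x : extpow k V) : (n < k)%N -> x = 0.
Proof.
move=> nk; apply/ffunP=> g; have := leq_card _ (@incseq_inj F k V g).
rewrite !card_ord => kV; have : (k <= n)%N by rewrite [n]dim_rV.
by rewrite leqNgt nk.
Qed.

Lemma extpow_natrep_projective k : (0 < k)%N ->
  projective_module (tmod (extrep k (natrep F n))).
Proof.
case: k => // k _; case: (leqP k.+1 n) => hk.
  exact: projective_retract (vcoverK hk).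
move=> M N g f _; exists \0 => x.
by rewrite /= (extpow_natrep_eq0 (x : extpow _ _) hk) !linear0.
Qed.

End CharZero.

End NaturalModule.
#[local] Opaque vcoef.

(** * The resolution *)
Section Resolution.
Variables (F : fieldType) (n : nat) (hn : (0 < n)%N).
Hypothesis F0 : [pchar F] =i pred0.
Local Notation V := 'rV[F]_n.
Local Notation U := (subvs_of (augsp F n)).
Local Notation A := (transf_alg F n).
Local Notation act k f := (trep_act (extrep k (natrep F n)) f).
Local Notation aact k f := (trep_act (extrep k (augrep F n)) f).
Local Notation last := (ord_last hn).

Lemma n_neq0 : n%:R != 0 :> F.
Proof. by have /pcharf0P-> := F0; rewrite -lt0n. Qed.

Lemma coord_sum_vvec (i : 'I_n) : coord_sum (vvec F i) = 1.
Proof.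
rewrite /coord_sum (bigD1 i) //= big1 => [|j /negPf ji].
  by rewrite mxE !eqxx addr0.
by rewrite mxE ji andbF.
Qed.

Lemma coord_sum_act (f : transf n) (x : V) :
  coord_sum (nat_act f x) = coord_sum x.
Proof.
rewrite [nat_act f x]/nat_act linear_sum; apply: eq_bigr => i _.
by rewrite linearZ /= [coord_sum _]coord_sum_vvec [LHS]mulr1.
Qed.

Definition average (x : V) : F^o := n%:R^-1 *: coord_sum x.

Lemma average_linear : linear average.
Proof.
by move=> a x y; rewrite /average linearP scalerDr !scalerA mulrC.
Qed.
HB.instance Definition _ :=
  GRing.isLinear.Build F V F^o *:%R average average_linear.

Lemma average_aug (x : U) : average (vsval x) = 0.
Proof.
have := subvsP x; rewrite mem_augsp /average => /eqP x0.
by rewrite [coord_sum _]x0 scaler0.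
Qed.

Lemma average_act (f : transf n) (x : V) : average (nat_act f x) = average x.
Proof. by rewrite /average coord_sum_act. Qed.

Lemma average_wvec i : average (wvec F hn i) = (i == last)%:R.
Proof.
rewrite /average /wvec; case: eqP => _; last first.
  by rewrite linearB /= !coord_sum_vvec subrr scaler0.
rewrite [coord_sum _]linear_sum; under eq_bigr do rewrite /= coord_sum_vvec.
by rewrite sumr_const card_ord [LHS]mulVf ?n_neq0.
Qed.

Lemma wvec_span (x : V) : exists a : 'I_n -> F, x = \sum_i a i *: wvec F hn i.
Proof.
pose s : F := average x; have sE : s * n%:R = coord_sum x.
  by rewrite /s /average [_ *: _]mulrC mulrVK ?unitfE ?n_neq0.
(* With [s] the average, [x - s w_n] has coordinate sum 0, hence equals the sum of the
   [(x_i - s)(v_i - v_n)]. *)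
exists (fun i => if i == last then s else x 0 i - s).
rewrite (bigD1 last) //= {1}/wvec eqxx.
have -> : \sum_(i < n | i != last)
    (if i == last then s else x 0 i - s) *: wvec F hn i =
    \sum_i (x 0 i - s) *: (vvec F i - vvec F last).
  rewrite [RHS](bigD1 last) //= subrr scaler0 add0r.
  by apply: eq_bigr => i /negPf il; rewrite /wvec il.
rewrite [X in _ = _ + X](eq_bigr (fun i => x 0 i *: vvec F i - s *: vvec F i
    - (x 0 i - s) *: vvec F last)) => [|i _]; last by rewrite scalerBr scalerBl.
rewrite !sumrB -[X in _ - X]scaler_suml sumrB -/(coord_sum x) -sE.
rewrite sumr_const card_ord mulr_natr subrr scale0r subr0.
by rewrite -scaler_sumr addrC subrK [LHS]row_sum_delta.
Qed.

Definition boundary k : {linear extpow k.+1 V -> extpow k V} :=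
  contraction average k.
#[local] Opaque boundary.

Lemma boundary_act k f x : boundary k (act k.+1 f x) = act k f (boundary k x).
Proof. exact/contraction_map/average_act. Qed.

Lemma boundary_wvec k (g : incseq k.+1 n) :
  boundary k (wedge [ffun j => wvec F hn (val g j)]) =
  if val g ord_max == last then wedge [ffun j => wvec F hn (init_seq (val g) j)]
  else 0.
Proof.
rewrite [LHS](@contraction_basis _ _ _ _ last) //; first last.
- exact: average_wvec.
- by move=> i; rewrite -ltnS /= prednK.
case: ifP => // _; congr wedge; apply/ffunP=> j; rewrite !ffunE.
by congr (wvec _ _ (val g _)); apply: val_inj; apply: lift_max.
Qed.

Lemma boundary_homotopy k (x : extpow k.+1 V) :
  wedge_right (wvec F hn last) k (boundary k x) +
  boundary k.+1 (wedge_right (wvec F hn last) k.+1 x) = x.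
Proof.
apply: contraction_homotopy; first exact: dim_rV.
- exact: wvec_span.
- by move=> i; rewrite -ltnS /= prednK.
- exact: average_wvec.
Qed.

Definition aug_incl k : {linear extpow k U -> extpow k V} :=
  extpow_map k (@vsval _ _ (augsp F n)).
Definition aug_proj k : {linear extpow k V -> extpow k U} :=
  extpow_map k (vsproj (augsp F n)).
#[local] Opaque aug_incl aug_proj.

Lemma aug_inclK k : cancel (@aug_incl k) (@aug_proj k).
Proof. by apply: extpow_mapK => x; apply: vsvalK. Qed.

Lemma aug_incl_act k f x : aug_incl k (aact k f x) = act k f (aug_incl k x).
Proof.
move: x; apply: (@extpow_linear_eq _ _ _ _ (aug_incl k \o aact k f)
  (act k f \o aug_incl k)) => u /=.
rewrite [X in aug_incl k X]extpow_map_wedge ![aug_incl k _]extpow_map_wedge.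
rewrite [RHS]extpow_map_wedge; congr wedge; apply/ffunP=> i.
by rewrite !ffunE.
Qed.

(** The boundary already lies in the exterior power of [augsp]; [aug_proj], which need not be
    equivariant, only restricts the codomain. *)
Definition augment k (x : extpow k.+1 V) : extpow k U :=
  aug_proj k (boundary k x).

Lemma augment_linear k : linear (@augment k).
Proof. by move=> a x y; rewrite /augment !linearP. Qed.
HB.instance Definition _ k := GRing.isLinear.Build F (extpow k.+1 V)
  (extpow k U) *:%R (@augment k) (@augment_linear k).

Lemma vsproj_wvec i :
  i != last -> vsproj (augsp F n) (wvec F hn i) = waug F hn i.
Proof.
move=> /negPf il; apply: val_inj; rewrite /= vsprojK /wvec il //.
exact: sub_vvec_aug.
Qed.

Lemma augmentK k x : aug_incl k (augment x) = boundary k x.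
Proof.
apply: (@contraction_project _ _ _ (wvec F hn) last); first exact: dim_rV.
- exact: wvec_span.
- by move=> i; rewrite -ltnS /= prednK.
- exact: average_wvec.
- move=> i il /=; rewrite vsprojK // /wvec (negPf il).
  exact: sub_vvec_aug.
Qed.

(** Equivariance can be tested after [aug_incl], which is injective and equivariant. *)
Lemma augment_act k f x : @augment k (act k.+1 f x) = aact k f (augment x).
Proof.
apply: (can_inj (@aug_inclK k)).
by rewrite augmentK boundary_act aug_incl_act augmentK.
Qed.

Definition augment_hom k :
    {linear tmod (extrep k.+1 (natrep F n)) -> tmod (extrep k (augrep F n))} :=
  @tmod_hom F n (extrep k.+1 (natrep F n)) (extrep k (augrep F n))
    (@augment k) (@augment_act k).

Definition boundary_hom k :
    {linear tmod (extrep k.+1 (natrep F n)) -> tmod (extrep k (natrep F n))} :=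
  @tmod_hom F n (extrep k.+1 (natrep F n)) (extrep k (natrep F n))
    (boundary k) (@boundary_act k).

Lemma augment_surj k y : exists x, @augment k x = y.
Proof.
(* In [y] wedged with [w_n], the average kills the factors of [y] and is 1 on [w_n]. *)
exists (wedge_right (wvec F hn last) k (aug_incl k y)).
apply: (can_inj (@aug_inclK k)); rewrite augmentK.
apply: contraction_wedge_right; first exact: average_aug.
by rewrite [LHS]average_wvec eqxx.
Qed.

Lemma augment_eq0 k x : @augment k x = 0 -> boundary k x = 0.
Proof. by rewrite -augmentK => ->; rewrite linear0. Qed.

Lemma augment_wvec k (g : incseq k.+1 n) :
  augment (wedge [ffun j => wvec F hn (val g j)]) =
  if val g ord_max == last then wedge [ffun j => waug F hn (init_seq (val g) j)]
  else 0.
Proof.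
rewrite /augment boundary_wvec; case: eqP => gl; last by rewrite linear0.
rewrite [LHS]extpow_map_wedge; congr wedge; apply/ffunP=> j.
rewrite !ffunE; apply: vsproj_wvec.
have -> : widen_ord (leq_pred k.+1) j = lift ord_max j.
  by apply/esym/val_inj; apply: lift_max.
apply: incseq_neq_last; last by rewrite eq_sym neq_lift.
by move=> i; rewrite -ltnS /= prednK.
Qed.

(** A boundary comes from the exterior power of [augsp], on which the average vanishes. *)
Lemma boundary_boundary k x : boundary k (boundary k.+1 x) = 0.
Proof.
rewrite -[boundary k.+1 x]augmentK.
exact: (contraction_ker _ average_aug).
Qed.

Lemma boundary_exact k x :
  boundary k x = 0 -> exists y, boundary k.+1 y = x.
Proof.
move=> bx; exists (wedge_right (wvec F hn last) k.+1 x).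
by rewrite -[RHS]boundary_homotopy bx linear0 add0r.
Qed.

Lemma kernel_superfluous k (N : lmodType A)
    (f : {linear tmod (extrep k.+1 (natrep F n)) -> N}) :
    (forall x, f x = 0 -> exists y, x = boundary k.+1 y) ->
  superfluous (kernel f).
Proof.
move=> fb X [X0 XP] XK; rewrite -subTset => x _.
have [hk|hk] := leqP k.+1 n; last first.
  by rewrite (extpow_natrep_eq0 (x : extpow _ _) hk).
pose x0 : tmod (extrep k.+1 (natrep F n)) := vwedge F (vstd hk).
have X_scale a z : X z -> X (a *: z).
  by move=> Xz; rewrite -[_ *: _]addr0; apply: XP.
suff Xx0 : X x0 by rewrite -(vcoverK F0 hk x); apply: X_scale.
(* [e] fixes [1, ..., k + 1] and sends all other points to 1. *)
pose e := extend (vstd hk).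
have e0 : act k.+1 e x0 = x0.
  rewrite [LHS]act_vwedge; congr vwedge; apply/ffunP=> j.
  by rewrite !ffunE /= inord_val.
have [y [z [Xy /fb[t zt] yz]]] := XK x0.
(* [z] is the boundary of some [t] in degree [k + 2], and [e] has too small a rank not to kill
   [t]. *)
have ez : act k.+1 e z = 0.
  rewrite zt -boundary_act (@act_rank_lt _ _ _ _ hk _ inord) ?linear0 //.
  by move=> i; rewrite !ffunE.
have -> : x0 = talg_of F e *: y.
  by rewrite tmod_ofE -[LHS]e0 yz linearD /= ez addr0.
exact: X_scale.
Qed.

Lemma extrep_aug_simple k : (k < n)%N ->
  simple_module (tmod (extrep k (augrep F n))).
Proof.
move=> hk; pose M : lmodType A := tmod (extrep k (augrep F n)).
pose eps : {linear tmod (extrep k.+1 (natrep F n)) -> M} :=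
  augment_hom k.
pose x0 : tmod (extrep k.+1 (natrep F n)) := vwedge F (vstd hk).
have M_gen (z : M) : exists a : A, z = a *: eps x0.
  have [y <-] := augment_surj z; exists (vcover y).
  by rewrite -linearZ vcoverK.
split.
  exists (eps x0) => e0; apply: (@vwedge_vstd_neq0 F n k.+1 hk).
  have : superfluous (kernel eps).
    apply: kernel_superfluous => x /augment_eq0/boundary_exact[y <-].
    by exists y.
  move=> /(_ [set 0]) s0; have : [set 0] x0.
    rewrite s0 // => [|x].
      by split=> // a x y -> ->; rewrite scaler0 addr0.
    exists 0, x; split; rewrite ?add0r //.
    by have [a xa] := M_gen (eps x); rewrite /kernel /= xa e0 scaler0.
  by [].
move=> K [K0 KP].
have K_scale a z : K z -> K (a *: z).
  by move=> Kz; rewrite -[_ *: _]addr0; apply: KP.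
have [[x [Kx x0n]]|] := pselect (exists x, K x /\ x <> 0); last first.
  move=> /forallNP H; left; apply/seteqP; split=> [x Kx|_ -> //].
  by apply: contrapT => x0n; apply: (H x).
right; rewrite -subTset => z _; have [a ->] := M_gen z.
apply: (K_scale) => {z a}.
have [t tx] : exists t, vcoef F t (aug_incl k x) != 0.
  apply: (vcoef_neq0 F0) => x0'; apply: x0n.
  by rewrite -[x](@aug_inclK k) x0' linear0.
have t_inj := vcoef_alternating tx.
(* [h] sends [t_j] to [j + 1] and every other point to the spare value 0, which absorbs the
   remaining coordinates. *)
pose h (i : 'I_n) : 'I_k.+1 :=
  if [pick j | t j == i] is Some j then lift ord0 j else ord0.
pose f : transf n := [ffun i => widen_ord hk (h i)].
have ht i j : (h i == lift ord0 j) = (t j == i).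
  rewrite /h; case: pickP => [j' /eqP<-|tN]; last first.
    by rewrite tN (negPf (neq_lift _ _)).
  by rewrite (inj_eq lift_inj) (inj_eq t_inj) eq_sym.
have fx : act k f (aug_incl k x) <> 0.
  move=> fx0; case/negP: tx.
  (* Only [t_j] is sent to [s_j], so the coefficient of the image at [s] is that of the original at
     [t]. *)
  pose s : {ffun 'I_k -> 'I_n} := [ffun j => widen_ord hk (lift ord0 j)].
  have fs l j : (s j == f l) = (t j == l).
    by rewrite !ffunE eq_sym -ht -[LHS]val_eqE -[RHS]val_eqE.
  suff <- : vcoef F s (act k f (aug_incl k x)) = vcoef F t (aug_incl k x).
    by rewrite fx0 linear0.
  move: (aug_incl k x); apply: (@extpow_linear_eq _ _ _ _
    (vcoef F s \o act k f) (vcoef F t)) => u /=.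
  rewrite act_wedge !vcoef_wedge; congr (\det _); apply/matrixP=> i j.
  rewrite !mxE [in LHS]ffunE /nat_act summxE (bigD1 (t j)) //= big1 => [|l lt].
    by rewrite !mxE fs !eqxx mulr1 addr0.
  by rewrite !mxE fs eq_sym (negPf lt) andbF mulr0.
(* One degree up, [f] maps any lift [y] of [x] to a multiple of the standard wedge. *)
have [y yx] := augment_surj x.
have [c fy] := act_rank_det (fun i => ffunE _ i : f i = widen_ord hk (h i)) y.
have xc : aact k f x = c *: (eps x0 : extpow k U).
  by rewrite -yx -augment_act fy linearZ.
have c0 : c != 0.
  apply/eqP=> c0; apply: fx; rewrite -aug_incl_act xc c0 scale0r.
  by rewrite linear0.
have -> : eps x0 = (c^-1 *: ((1%R : A) : {ffun transf n -> F^o}) : A) *: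
    (talg_of F f *: x).
  rewrite tmod_ofE xc -[RHS]/(tmod_eval _ _) tmod_scale_const.
  by rewrite scalerA mulVf // scale1r.
by apply: (K_scale); apply: (K_scale).
Qed.

End Resolution.
#[local] Opaque boundary aug_incl aug_proj.

(** * Minimality of the resolution and projective dimension *)

Section Assembly.
Variables (F : fieldType) (n : nat) (hn : (0 < n)%N).
Hypothesis F0 : [pchar F] =i pred0.
Variables (k : nat) (hk : (k < n)%N).
Local Notation A := (transf_alg F n).

Let M : lmodType A := tmod (extrep k (augrep F n)).
Let P q : lmodType A := tmod (extrep (q + k.+1) (natrep F n)).
Let eps : {linear P 0%N -> M} := augment_hom hn F0 k.
Let d q : {linear P q.+1 -> P q} := boundary_hom F n (q + k.+1).

Lemma wedge_resolution_vanishes : vanishes_above P (n - k.+1).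
Proof.
move=> q; rewrite ltn_subLR // addnC => nq x.
exact: extpow_natrep_eq0 (x : extpow _ _) nq.
Qed.

Lemma wedge_resolution_exact : projective_resolution eps d.
Proof.
split.
- by move=> q; apply: extpow_natrep_projective; rewrite // addnS.
- by rewrite -subTset => y _; have [x xy] := augment_surj hn F0 y; exists x.
- apply/seteqP; split=> [_ [x _ <-]|x /(augment_eq0 hn F0)].
    by rewrite /kernel /= /augment boundary_boundary ?linear0.
  by move=> /(boundary_exact hn F0)[y yx]; exists y.
- move=> q; apply/seteqP; split=> [_ [x _ <-]|x].
    exact: (boundary_boundary hn F0).
  by move=> /(boundary_exact hn F0)[y yx]; exists y.
Qed.

Lemma wedge_resolution_minimal : minimal_projective_resolution eps d.
Proof.
have res := wedge_resolution_exact; have [pP _ _ _] := res.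
split=> // [|q]; split=> //.
  apply: (kernel_superfluous F0) => x /(augment_eq0 hn F0).
  by move=> /(boundary_exact hn F0)[y <-]; exists y.
apply: (kernel_superfluous F0 (k := q + k.+1)) => x.
by move=> /(boundary_exact hn F0)[y <-]; exists y.
Qed.

Lemma wedge_projective_dimension : projective_dimension_is M (n - k.+1).
Proof.
split.
  exists P, eps, d; split; first exact: wedge_resolution_exact.
  exact: wedge_resolution_vanishes.
apply: (minimal_resolution_length wedge_resolution_minimal) => [q|].
  exact: tmod_hopfian.
(* The top term is the [n]-th exterior power, which is nonzero; its exponent stays a sum because the
   type depends on it. *)
have leq_n : (n - k.+1 + k.+1 <= n)%N by rewrite subnK.
by exists (vwedge F (vstd leq_n)); apply: vwedge_vstd_neq0.
Qed.

End Assembly.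

(** * The zeroth exterior power as the trivial module *)

Section Trivial.
Variables (F : fieldType) (n : nat) (V : trep F n).
Local Notation A := (transf_alg F n).

Let u0 : {ffun 'I_0 -> V} := [ffun => 0].

Lemma wedge0 (u : {ffun 'I_0 -> V}) : wedge u = wedge u0.
Proof. by congr wedge; apply/ffunP; case. Qed.

Definition ext0_coef : {linear extrep 0 V -> trivrep F n} :=
  extpow_lift (fun _ : {ffun 'I_0 -> V} => 1 : F^o).
#[local] Opaque ext0_coef.

Lemma ext0_coef_wedge u : ext0_coef (wedge u) = 1.
Proof.
apply: (extpow_lift_wedge (phi := fun _ : {ffun 'I_0 -> V} => 1 : F^o)).
  by move=> ? [].
by move=> ? [].
Qed.

Lemma ext0_coef_act t x :
  ext0_coef (trep_act (extrep 0 V) t x) =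
  trep_act (trivrep F n) t (ext0_coef x).
Proof.
move: x; apply: (@extpow_linear_eq _ _ _ _
  (ext0_coef \o trep_act (extrep 0 V) t) ext0_coef) => u /=.
by rewrite [X in ext0_coef X]extpow_map_wedge !ext0_coef_wedge.
Qed.

Definition ext0_const (c : trivrep F n) : extrep 0 V := (c : F) *: wedge u0.

Lemma ext0_const_linear : linear ext0_const.
Proof. by move=> a x y; rewrite /ext0_const scalerDl scalerA. Qed.
HB.instance Definition _ := GRing.isLinear.Build F (trivrep F n) (extrep 0 V)
  *:%R ext0_const ext0_const_linear.

Lemma ext0_const_act t c :
  ext0_const (trep_act (trivrep F n) t c) =
  trep_act (extrep 0 V) t (ext0_const c).
Proof.
rewrite [in RHS]/ext0_const linearZ; congr (_ *: _).
by rewrite [RHS]extpow_map_wedge wedge0.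
Qed.

Lemma ext0_coefK : cancel ext0_coef ext0_const.
Proof.
apply: (@extpow_linear_eq _ _ _ _ (ext0_const \o ext0_coef) idfun) => u /=.
by rewrite ext0_coef_wedge /ext0_const scale1r [RHS]wedge0.
Qed.

Lemma ext0_constK : cancel ext0_const ext0_coef.
Proof.
by move=> c; rewrite /ext0_const linearZ ext0_coef_wedge; apply: mulr1.
Qed.

Lemma ext0_projective_dimension l :
  projective_dimension_is (tmod (extrep 0 V) : lmodType A) l ->
  projective_dimension_is (tmod (trivrep F n) : lmodType A) l.
Proof.
exact: (@projective_dimension_iso A (tmod (extrep 0 V)) (tmod (trivrep F n))
  (tmod_hom ext0_coef_act)
  (@tmod_hom F n (trivrep F n) (extrep 0 V) ext0_const ext0_const_act)
  _ ext0_coefK ext0_constK).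
Qed.

End Trivial.

Unset Implicit Arguments.

Local Open Scope complex_scope.

Theorem corollary3p4 (R : realType) (n : nat) (hn : (1 <= n)%N) :
  (forall (r : nat) (hr : (1 <= r)%N), (r <= n)%N ->
    let M : lmodType (transf_alg R[i] n) :=
      tmod (extrep r.-1 (augrep R[i] n)) in
    let P (q : nat) : lmodType (transf_alg R[i] n) :=
      tmod (extrep (q + r) (natrep R[i] n)) in
    [/\ simple_module M,
        exists (eps : {linear P 0%N -> M})
          (d : forall q : nat, {linear P q.+1 -> P q}),
          [/\ forall g : incseq r n,
                eps (wedge [ffun j => wvec R[i] hn (val g j)]) =
                if val g (ord_last hr) == ord_last hn
                then wedge [ffun j => waug R[i] hn (init_seq (val g) j)]
                else 0,
              forall (q : nat) (g : incseq (q.+1 + r) n),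
                d q (wedge [ffun j => wvec R[i] hn (val g j)]) =
                if val g (ord_last (ltn0Sn (q + r))) == ord_last hn
                then wedge [ffun j => wvec R[i] hn (init_seq (val g) j)]
                else 0,
              vanishes_above P (n - r)
            & minimal_projective_resolution eps d]
      & projective_dimension_is M (n - r)]) /\
  projective_dimension_is
    (tmod (trivrep R[i] n) : lmodType (transf_alg R[i] n)) (n - 1).
Proof.
have F0 : [pchar R[i]] =i pred0 by apply: Num.Theory.pchar_num.
split; last first.
  (* The trivial module is the case [r = 1]; the second [hn] is read as [k < n] with [k = 0]. *)
  apply: (ext0_projective_dimension (V := augrep R[i] n)).
  exact: (wedge_projective_dimension hn F0 hn).
move=> [//|k] hr hk M P; split.
- exact: (extrep_aug_simple hn F0 hk).
- exists (augment_hom hn F0 k), (fun q => boundary_hom R[i] n (q + k.+1)).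
  have lastE m (h : (0 < m.+1)%N) : ord_last h = ord_max by apply: val_inj.
  split.
  + by move=> g; rewrite [LHS](augment_wvec hn F0) lastE.
  + by move=> q g; rewrite [LHS](boundary_wvec hn F0) lastE.
  + exact: wedge_resolution_vanishes.
  + exact: (wedge_resolution_minimal hn F0).
- exact: (wedge_projective_dimension hn F0 hk).
Qed.
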